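(* There is a universal constant $C>0$ such that for any $2/3<\xi\le1$ and $0<\alpha<1$ there exist constants $\delta>0$ and $q_0>0$ with the following property. Let $H$ be a half-line discrete Schrödinger operator on $\ell^2(\mathbb{N})$ with bounded real potential $V$, let $q\ge q_0$ be an integer, and suppose that the set $\mathfrak{E}_q=\{\widetilde E_{q,1},\dots,\widetilde E_{q,q}\}$ is $(q^{-1/\alpha},\xi)$-clustered. Then for all $T>0$ with $T\le q^{1/\alpha}$, $$P(q,T)\le 4e^2\bigl(1+2\|V\|_\infty\bigr)^2T^4\Bigl(\sup_{1\le j\le q}b_{q,j}\Bigr)^2e^{-Cq^\delta}.$$ In particular, $$P(q,q^{1/\alpha})\le 4e^2\bigl(1+2\|V\|_\infty\bigr)^2q^{4/\alpha}\Bigl(\sup_{1\le j\le q}b_{q,j}\Bigr)^2e^{-Cq^\delta}.$$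
   Context: $\mathbb{N}=\{1,2,\dots\}$; $V=(V_n)_{n\in\mathbb{N}}$ is a bounded real sequence, $\|V\|_\infty=\sup_n|V_n|$. The operator $H$ on $\ell^2(\mathbb{N})$ is $(H\psi)_n=\psi_{n+1}+\psi_{n-1}+V_n\psi_n$ for $n\ge2$ and $(H\psi)_1=\psi_2+V_1\psi_1$. For $T>0$, $$P(q,T)=\sum_{n>q}\frac2T\int_0^\infty\bigl|\langle\delta_n,e^{-itH}\delta_1\rangle\bigr|^2e^{-2t/T}\,dt .$$ For an integer $q>1$ and $k\in[0,\pi]$, $H^q(k)$ is the $q\times q$ Hermitian matrix with diagonal entries $V_1,\dots,V_q$, entries $1$ in positions $(n,n\pm1)$, entry $e^{-ik}$ in position $(1,q)$ and $e^{ik}$ in position $(q,1)$, and all other entries $0$ (for $q=2$ the entries falling in the same position are added). $E_{q,1}(k)\le\dots\le E_{q,q}(k)$ are its eigenvalues in increasing order with multiplicity (simple for $k\in(0,\pi)$); $b_{q,j}=|E_{q,j}(\pi)-E_{q,j}(0)|$ and $\widetilde E_{q,j}=E_{q,j}(\pi/2)$. The set $\mathfrak{E}_q=\{\widetilde E_{q,j}\}_{j=1}^q$ is $(\varepsilon,\xi)$-clustered if there is a finite collection $\{I_j\}_{j=1}^k$ ($k\le q$) of disjoint closed intervals, each of length at most $\varepsilon$, such that $\mathfrak{E}_q\subseteq\bigcup_{j=1}^kI_j$ and every $I_j$ contains at least $q^\xi$ points of $\mathfrak{E}_q$. *)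

(* Defs.v *)
From HB Require Import structures.
From mathcomp Require Import all_boot all_order all_algebra.
From mathcomp Require Import finmap complex.
From mathcomp Require Import all_classical all_reals all_analysis.

Set Implicit Arguments.
Unset Strict Implicit.
Unset Printing Implicit Defensive.

Import Order.TTheory GRing.Theory Num.Theory ComplexField.
Import numFieldNormedType.Exports.

Local Open Scope classical_set_scope.
Local Open Scope complex_scope.
Local Open Scope ring_scope.

(* The lattice N = {1, 2, ...} is indexed from 0: the n-th site is stored at
   index n - 1, so index 0 is the boundary site, and "site > q" becomes
   "index >= q".  Likewise matrix rows, columns and eigenvalue labels 1, ..., q
   become 0, ..., q - 1. *)

Section Operator.
Variable R : realType.
Implicit Types (V : nat -> R) (psi phi : nat -> R[i]).

Definition sup_norm V : R := sup (range (fun n => `|V n|)).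

Definition l2_normsq psi : \bar R :=
  (\sum_(0 <= n <oo) (Normc.normc (psi n) ^+ 2)%:E)%E.

Definition l2 : set (nat -> R[i]) := [set psi | (l2_normsq psi < +oo)%E].

Definition delta (m : nat) : nat -> R[i] := fun n => (n == m)%:R.

(* For bounded V this maps l2 into l2 and is a bounded operator there. *)
Definition schrodinger V psi : nat -> R[i] := fun n =>
  psi n.+1 + (if n is m.+1 then psi m else 0) + (V n)%:C * psi n.

Definition exp_partial V (t : R) psi (m : nat) : nat -> R[i] :=
  \sum_(k < m) ((- (0 +i* t)%C) ^+ k / (k`!)%:R) *: iter k (schrodinger V) psi.

(* e^{-itH} psi, the l2-limit of the exponential series; for psi in l2 and
   V bounded this limit exists and is unique (0 is a default value otherwise). *)
Definition exp_mitH V (t : R) psi : nat -> R[i] :=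
  xget 0 [set phi | l2 phi /\
    l2_normsq (exp_partial V t psi m - phi) @[m --> \oo] --> 0%E].

(* The inner product <delta_n, phi> is the coordinate phi n. *)
Definition amplitude V (n : nat) (t : R) : R[i] := exp_mitH V t (delta 0) n.

Definition outside_prob V (q : nat) (T : R) : \bar R :=
  (\sum_(q <= n <oo)
     (2 / T)%:E *
     \int[lebesgue_measure]_(t in `[0%R, +oo[)
        (Normc.normc (amplitude V n t) ^+ 2 * expR (- (2 * t / T)))%:E)%E.

End Operator.

Section Floquet.
Variable R : realType.
Implicit Types (V : nat -> R) (q : nat) (k : R).

Definition cis k : R[i] := (cos k +i* sin k)%C.

(* The four contributions are added, which matters only for q = 2. *)
Definition floquet_mx V q k : 'M[R[i]]_q :=
  \matrix_(i < q, j < q)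
    ((V i)%:C *+ (i == j)
     + ((i.+1 == j :> nat) || (j.+1 == i :> nat))%:R
     + cis (- k) *+ ((i == 0%N :> nat) && (j.+1 == q :> nat))
     + cis k *+ ((i.+1 == q :> nat) && (j == 0%N :> nat))).

(* Roots of the characteristic polynomial with multiplicity, in increasing
   order; taking real parts loses nothing for a Hermitian matrix. *)
Definition eigenvalues q (A : 'M[R[i]]_q) : seq R :=
  sort <=%R [seq complex.Re z | z <- sval (closed_field_poly_normal (char_poly A))].

Definition Eband V q (j : nat) k : R := nth 0 (eigenvalues (floquet_mx V q k)) j.

Definition bandwidth V q (j : nat) : R := `|Eband V q j pi - Eband V q j 0|.

Definition max_bandwidth V q : R := \big[Num.max/0]_(j < q) bandwidth V q j.

Definition Etilde V q (j : nat) : R := Eband V q j (pi / 2).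

Definition frakE V q : set R := [set Etilde V q j | j in `I_q].

Definition clustered q (eps xi : R) (S : set R) : Prop :=
  exists (m : nat) (a b : 'I_m -> R),
    [/\ (m <= q)%N,
        forall j, a j <= b j /\ b j - a j <= eps,
        trivIset [set: 'I_m] (fun j => [set` `[a j, b j]]),
        S `<=` \bigcup_(j in [set: 'I_m]) [set` `[a j, b j]]
      & forall j, q%:R `^ xi <=
          (#|` fset_set (S `&` [set` `[a j, b j]]) |)%:R].

End Floquet.

(* Main.v *)
Require Import Defs.
From mathcomp Require Import all_boot all_order all_fingroup all_algebra.
From mathcomp Require Import finmap complex.
From mathcomp Require Import all_classical all_reals all_analysis.
From mathcomp Require Import measurable_realfun.
From mathcomp Require Import ring lra zify.
Import Order.TTheory GRing.Theory Num.Theory.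
Import numFieldNormedType.Exports.
Import ComplexField.
Local Open Scope classical_set_scope.
Local Open Scope ring_scope.

Set Implicit Arguments.
Unset Strict Implicit.
Unset Printing Implicit Defensive.

(** Let [D] be the discriminant: the characteristic polynomial of the Floquet
    matrix at quasimomentum [k] is [D - 2 cos k], so the [Etilde] are the zeros
    [e_j] of [D], and [D - 2], [D + 2] split over the reals too.  Writing both as
    products, some band contains a given [e_j] strictly between its two edges;
    comparing [D + 2] or [D - 2] at [e_j] and at the first band edge to its right
    gives [|D'(e_j)| >= 1 / B], with [B] the largest band width.

    Put [a_j = 1 / D'(e_j)] and [k(t) = sum_j a_j exp (- i e_j t)], so that
    [1 / D(z) = sum_j a_j / (z - e_j)].  As [D(i d/dt)] applied to the amplitude
    [psi_q] is [(D(H) psi)_q], the amplitude is the convolution of [k] with this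
    function.  The latter is controlled by unitarity: [p_q(H) delta_0 = delta_q]
    for the orthogonal polynomial [p_q], and the second term of [D] is driven by
    the half-line operator started one site later.  Past [q] the mass is bounded by
    the flux through [q].

    It remains to bound the weighted L2 norm of [k].  Expanding the square,
    [int |k|^2 exp (- h t) dt = sum_{j,l} a_j a_l / (h + i (e_j - e_l))
    <= sum_j |a_j| / |D(e_j + i h)|] with [h = 1 / T].  Partial fractions give
    [1 / |D(e_j + i h')| <= q B / h'], and passing from [h' = min (1, h) / 2] to [h]
    multiplies each of the [q^xi] factors of [|D|] coming from the cluster of [e_j]
    by a constant larger than 1: this is the exponential gain. *)

(** * The discriminant of the Floquet matrices *)

(** The determinant of the tridiagonal matrix with diagonal [d 0], ..., [d (n - 1)] and off-diagonal
    entries 1. As a function of [n] it solves [u (n + 1) = d n u n - u (n - 1)] with [u (- 1) = 0]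
    and [u 0 = 1]. *)
Fixpoint continuant (K : pzRingType) (d : nat -> K) (n : nat) : K :=
  if n is m.+1 then d m * continuant d m - (if m is k.+1 then continuant d k else 0)
  else 1.

(** The second solution of the same recurrence, with values 0 and 1 at [n = 0] and [n = 1]. *)
Definition continuant2 (K : pzRingType) (d : nat -> K) (n : nat) : K :=
  if n is m.+1 then continuant (fun i => d i.+1) m else 0.

Arguments continuant : simpl never.
Arguments continuant2 : simpl never.

Section PeriodicJacobi.
Variable K : comNzRingType.
Implicit Types (d u : nat -> K) (n q : nat).

Lemma continuantSS d n :
  continuant d n.+2 = d n.+1 * continuant d n.+1 - continuant d n.
Proof. by []. Qed.

Lemma continuant2SS d n :
  continuant2 d n.+2 = d n.+1 * continuant2 d n.+1 - continuant2 d n.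
Proof. by case: n. Qed.

(** The discrete Wronskian of two solutions of the recurrence is conserved. *)
Lemma continuant_wronskian d n :
  continuant d n * continuant2 d n.+1 - continuant2 d n * continuant d n.+1 = 1.
Proof.
elim: n => [|n IH]; first by rewrite /= mulr1 mul0r subr0.
by rewrite continuant2SS continuantSS -IH; ring.
Qed.

Lemma det_mx22 (M : 'M[K]_2) : \det M = M 0 0 * M 1 1 - M 0 1 * M 1 0.
Proof.
rewrite (expand_det_row _ ord0) big_ord_recl big_ord1 /cofactor !det_mx11 !mxE /=.
rewrite expr0 mul1r expr1 mulN1r mulrN.
by congr (_ * M _ _ - M _ _ * M _ _); apply/val_inj.
Qed.

(** The shape of the characteristic matrix of a Floquet matrix, with free corner entries; [d], [c1],
    [c2] will be polynomials. *)
Definition periodic_jacobi_mx d (c1 c2 : K) q : 'M[K]_q :=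
  \matrix_(i < q, j < q)
    (d i *+ (i == j) - ((i.+1 == j :> nat) || (j.+1 == i :> nat))%:R
     + c1 *+ ((i == 0%N :> nat) && (j.+1 == q :> nat))
     + c2 *+ ((i.+1 == q :> nat) && (j == 0%N :> nat))).

Lemma sum_mulrb_eq_nat q u a :
  \sum_(l < q) (u l *+ (l == a :> nat)) = u a *+ (a < q)%N.
Proof.
case: ltnP => aq.
  rewrite (bigD1 (Ordinal aq)) //= eqxx big1 ?addr0 // => l la.
  by rewrite (_ : (l == a :> nat) = false) //; apply/negbTE.
rewrite big1 // => l _; rewrite (_ : (l == a :> nat) = false) //.
by apply/negbTE; rewrite neq_ltn (leq_trans (ltn_ord l) aq).
Qed.

(** The sequence [u] lives on all of [nat], so that solutions of the recurrence can be inserted; the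
    last row lacks the neighbour [u q]. *)
Lemma periodic_jacobi_row d c1 c2 q u (i : 'I_q) : (1 < q)%N ->
  \sum_l periodic_jacobi_mx d c1 c2 q i l * u l =
  d i * u i - (if (i : nat) is k.+1 then u k else 0) - u i.+1 *+ (i.+1 < q)%N
  + (c1 * u q.-1) *+ (i == 0%N :> nat) + (c2 * u 0%N) *+ (i.+1 == q :> nat).
Proof.
move=> q1.
transitivity (\sum_(l < q) (d i * u l) *+ (l == i :> nat)
   - \sum_(l < q) u l *+ (l == i.+1 :> nat)
   - \sum_(l < q) (u l *+ (i != 0%N :> nat)) *+ (l == i.-1 :> nat)
   + \sum_(l < q) (c1 * u l *+ (i == 0%N :> nat)) *+ (l == q.-1 :> nat)
   + \sum_(l < q) (c2 * u l *+ (i.+1 == q :> nat)) *+ (l == 0%N :> nat)).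
  rewrite -!sumrB -!big_split /=; apply: eq_bigr => l _.
  rewrite mxE (_ : (i == l) = (l == i :> nat)); last by rewrite eq_sym.
  have -> : (i.+1 == l :> nat) || (l.+1 == i :> nat) =
     ((l == i.+1 :> nat) + ((i != 0%N :> nat) && (l == i.-1 :> nat)))%N :> nat by lia.
  have -> : (l.+1 == q :> nat) = (l == q.-1 :> nat) by lia.
  by rewrite -!mulnb; ring.
rewrite (sum_mulrb_eq_nat q (fun l => d i * u l)) (sum_mulrb_eq_nat q u).
rewrite (sum_mulrb_eq_nat q (fun l => u l *+ (i != 0%N :> nat))).
rewrite (sum_mulrb_eq_nat q (fun l => c1 * u l *+ (i == 0%N :> nat))).
rewrite (sum_mulrb_eq_nat q (fun l => c2 * u l *+ (i.+1 == q :> nat))).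
have -> : (i < q)%N by [].
have -> : (i.-1 < q)%N by apply: leq_ltn_trans (ltn_ord i); exact: leq_pred.
have -> : (q.-1 < q)%N by lia.
have -> : (0 < q)%N by lia.
rewrite !mulr1n; case: i => [[|i] Hi] /=; rewrite ?mulr0n ?mulr1n ?subr0; ring.
Qed.

(* The columns 0 and 1 are replaced by the two solutions of the three-term
   recurrence; the product then has zero entries there in rows 1, ..., q - 2. *)
Lemma det_periodic_jacobi d c1 c2 r : c1 * c2 = 1 ->
  exists e : bool, \det (periodic_jacobi_mx d c1 c2 r.+3) =
    (-1) ^+ e * (continuant d r.+3 - continuant2 d r.+2 + c1 + c2).
Proof.
move=> c12; set q := r.+3; set A := periodic_jacobi_mx _ _ _ _.
pose col (j : nat) (i : nat) : K :=
  if j is 0 then continuant d i else if j is 1 then continuant2 d i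
  else (i == j)%:R.
pose S : 'M[K]_q := \matrix_(i, j) col j i.
(* [S] is lower triangular with unit diagonal, since [continuant2] vanishes at 0 and both solutions
   start with a 1 on the diagonal. *)
have detS : \det S = 1.
  rewrite det_trig; last first.
    apply/is_trig_mxP => i j ij; rewrite mxE; case: j ij => -[|[|j]] Hj //= ij.
      by rewrite (_ : nat_of_ord i = 0%N) //; move: ij => /=; lia.
    by rewrite (_ : (nat_of_ord i == j.+2) = false) //; move: ij => /=; lia.
  rewrite big1 // => i _; rewrite mxE; case: i => -[|[|i]] Hi //=.
  by rewrite eqxx.
pose N := A *m S.
have detN : \det N = \det A by rewrite det_mulmx detS mulr1.
have NE i j : N i j = \sum_l A i l * col j l.
  by rewrite mxE; apply: eq_bigr => l _; rewrite !mxE.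
have N2 i (j : 'I_q) : (1 < j)%N -> N i j = A i j.
  move=> j1; rewrite NE (bigD1 j) //= big1 ?addr0.
    by case: j j1 => -[|[|j]] Hj //= _; rewrite eqxx mulr1.
  by move=> l lj; case: j j1 lj => -[|[|j]] Hj //= _ lj;
     rewrite (_ : (nat_of_ord l == j.+2) = false) ?mulr0 //; apply/negbTE.
(* Rotating the last row to the top puts the two boundary rows first. The matrix is then block upper
   triangular: the lower left block vanishes by the recurrence, and the lower right one is
   triangular with diagonal entries -1. *)
pose shiftn (i : 'I_q) : 'I_q := if (i : nat) is k.+1 then inord k else ord_max.
have shiftnE i : val (shiftn i) = if (i : nat) is k.+1 then k else r.+2.
  by rewrite /shiftn; case: i => -[|i] Hi //=; rewrite inordK // ltnW.
have shiftn_inj : injective shiftn.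
  move=> i j /(congr1 val); rewrite !shiftnE => E; apply/val_inj => /=.
  have := ltn_ord i; have := ltn_ord j.
  by case: (nat_of_ord i) E => [|k]; case: (nat_of_ord j) => [|l] //=; rewrite /q; lia.
pose s := perm shiftn_inj.
pose N' : 'M[K]_(2 + r.+1) := row_perm s N.
have detN' : \det N' = (-1) ^+ s * \det A.
  by rewrite /N' row_permE det_mulmx det_perm detN.
have N'E (i j : 'I_q) : N' i j = \sum_l A (shiftn i) l * col j l.
  by rewrite mxE permE NE.
have N'E2 (i j : 'I_q) : (1 < j)%N -> N' i j = A (shiftn i) j.
  by move=> j1; rewrite mxE permE N2.
have dl0 : dlsubmx N' = 0.
  apply/matrixP => i j; have Hi := ltn_ord i.
  have -> : dlsubmx N' i j = N' (rshift 2 i) (lshift r.+1 j) by do 2 rewrite [LHS]mxE.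
  rewrite N'E periodic_jacobi_row // shiftnE /= mxE.
  have -> : (i.+2 < q)%N by rewrite /q; lia.
  have -> : (i.+2 == q) = false by apply/negbTE; rewrite /q; lia.
  rewrite !mulr0n !addr0 mulr1n.
  by case: j => -[|[|j]] Hj //=; rewrite ?continuantSS ?continuant2SS; ring.
have dr_det : exists b : bool, \det (drsubmx N') = (-1) ^+ b.
  have E2 (i j : 'I_r.+1) : (i <= j)%N -> drsubmx N' i j = - (i == j)%:R.
    move=> ij; have Hi := ltn_ord i; have Hj := ltn_ord j.
    have -> : drsubmx N' i j = N' (rshift 2 i) (rshift 2 j) by do 2 rewrite [LHS]mxE.
    rewrite N'E2 // mxE -!val_eqE shiftnE /= shiftnE.
    have -> : ((1 + i)%N == (2 + j)%N) = false by lia.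
    rewrite andbF /= !mulr0n !addr0 add0r.
    by congr (- (nat_of_bool _)%:R); lia.
  exists (odd r.+1); rewrite signr_odd det_trig; last first.
    apply/is_trig_mxP => i j ij.
    by rewrite E2 ?(ltnW ij)// (_ : (i == j) = false) ?oppr0 // -val_eqE /=; lia.
  under eq_bigr do rewrite E2 // eqxx.
  by rewrite prodr_const card_ord.
have ul_det : \det (ulsubmx N') = - (continuant d r.+3 - continuant2 d r.+2 + c1 + c2).
  have ulE i j : ulsubmx N' i j = N' (lshift r.+1 i) (lshift r.+1 j).
    by do 2 rewrite [LHS]mxE.
  have r2 : continuant d r.+3 = d r.+2 * continuant d r.+2 - continuant d r.+1 by [].
  have s2 := continuant2SS d r.+1.
  have W := continuant_wronskian d r.+2.
  rewrite det_mx22 !ulE.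
  rewrite !N'E !periodic_jacobi_row // !shiftnE /=.
  rewrite /q !ltnn !eqxx /= !mulr0n !mulr1n !subr0 !addr0 /=.
have P1 : continuant d 1 = d 0%N by rewrite /continuant mulr1 subr0.
  have [S0 S1] : continuant2 d 0 = 0 /\ continuant2 d 1 = 1 by [].
  have P0 : continuant d 0 = 1 by [].
  rewrite P1 P0 S0 S1.
  (* The only quadratic terms in the solutions form a Wronskian, so the 2 by 2 determinant becomes
     linear in them. *)
  transitivity (c1 * c2 * continuant2 d r.+2 - continuant d r.+3 - c2
     - c1 * (continuant d r.+2 * continuant2 d r.+3
             - continuant2 d r.+2 * continuant d r.+3)); first by rewrite r2 s2; ring.
  by rewrite W c12; ring.
have := det_ublock (ulsubmx N') (ursubmx N') (drsubmx N').
rewrite -dl0 submxK detN'.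
case: dr_det => b ->; rewrite ul_det => H.
exists (~~ (b (+) s)).
apply: (can_inj (signrMK s)); rewrite H signrN signr_addb.
set X := (_ - _ + _ + _); set B := (-1) ^+ b; set Z := (-1) ^+ s.
have ZZ : Z * Z = 1 by rewrite /Z -signr_addb addbb.
have -> : Z * (- (B * Z) * X) = (Z * Z) * (- X * B) by ring.
by rewrite ZZ mul1r.
Qed.
End PeriodicJacobi.

Section Discriminant.
Variable R : realType.
Implicit Types (V : nat -> R) (q : nat) (k : R).

Definition jacobi_poly V n : {poly R} := continuant (fun i => 'X - (V i)%:P) n.
Definition jacobi_poly2 V n : {poly R} := continuant2 (fun i => 'X - (V i)%:P) n.
Definition discriminant V q : {poly R} := jacobi_poly V q - jacobi_poly2 V q.-1.

Lemma rmorph_continuant (K L : comNzRingType) (phi : {rmorphism K -> L}) d n :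
  phi (continuant d n) = continuant (phi \o d) n.
Proof.
have [//] : phi (continuant d n) = continuant (phi \o d) n /\
  phi (continuant d n.+1) = continuant (phi \o d) n.+1.
elim: n => [|n [IH1 IH2]]; first by rewrite /continuant /= !mulr1 !subr0 rmorph1.
by split=> //; rewrite continuantSS rmorphB rmorphM /= IH1 IH2.
Qed.

Lemma rmorph_continuant2 (K L : comNzRingType) (phi : {rmorphism K -> L}) d n :
  phi (continuant2 d n) = continuant2 (phi \o d) n.
Proof. by case: n => [|n]; [exact: rmorph0|exact: rmorph_continuant]. Qed.

Lemma continuant_monic V n :
  jacobi_poly V n \is monic /\ size (jacobi_poly V n) = n.+1.
Proof.
have H m : size (jacobi_poly V m) = m.+1 -> jacobi_poly V m \is monic ->
  (('X - (V m)%:P) * jacobi_poly V m \is monic) /\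
  size (('X - (V m)%:P) * jacobi_poly V m) = m.+2.
  move=> s mo; split; first by rewrite monicMl // monicXsubC.
  by rewrite size_monicM ?monicXsubC ?monic_neq0// size_XsubC s.
have [] // : (jacobi_poly V n \is monic /\ size (jacobi_poly V n) = n.+1) /\
  (jacobi_poly V n.+1 \is monic /\ size (jacobi_poly V n.+1) = n.+2).
elim: n => [|n [[m0 s0] [m1 s1]]].
  rewrite /jacobi_poly /continuant mulr1 subr0.
  by rewrite monic1 size_poly1 monicXsubC size_XsubC.
split=> //; have [m2 s2] := H n.+1 s1 m1.
have sz : (size (- jacobi_poly V n) < size (('X - (V n.+1)%:P) * jacobi_poly V n.+1)%R)%N.
  by rewrite size_polyN s0 s2.
split; last by rewrite /jacobi_poly continuantSS size_polyDl.
by rewrite /jacobi_poly continuantSS monicE lead_coefDl.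
Qed.

Lemma size_jacobi_poly2 V n : (size (jacobi_poly2 V n) <= n)%N.
Proof.
case: n => [|n]; first by rewrite size_poly0.
by have [_] := continuant_monic (fun i => V i.+1) n; rewrite /jacobi_poly => ->.
Qed.

Lemma discriminant_subC_monic V q c : (2 < q)%N ->
  discriminant V q - c%:P \is monic /\ size (discriminant V q - c%:P) = q.+1.
Proof.
move=> q2; have [m s] := continuant_monic V q.
have sz : (size (- jacobi_poly2 V q.-1 - c%:P)%R < size (jacobi_poly V q))%N.
  rewrite s ltnS (leq_trans (size_polyD _ _)) // !size_polyN geq_max.
  rewrite (leq_trans (size_jacobi_poly2 _ _)) ?leq_pred //.
  by rewrite (leq_trans (size_polyC_leq1 _)) //; lia.
rewrite /discriminant -addrA size_polyDl // s.
by split=> //; rewrite monicE lead_coefDl.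
Qed.

(** Over polynomials the corners are [- exp (- i k)] and [- exp (i k)]. Their product is 1 and their
    sum is [- 2 cos k], so [k] enters only through the constant term. *)
Lemma char_poly_floquet V q k : (2 < q)%N ->
  char_poly (floquet_mx V q k) =
  map_poly (real_complex R) (discriminant V q - (2 * cos k)%:P).
Proof.
move=> q2; set phi : {rmorphism {poly R} -> {poly R[i]}} := map_poly (real_complex R).
have phiC c : phi c%:P = (real_complex R c)%:P by rewrite /= map_polyC.
have phiX c : phi ('X - c%:P) = 'X - (real_complex R c)%:P by rewrite /= map_polyXsubC.
pose d := phi \o (fun i => 'X - (V i)%:P).
pose c1 : {poly R[i]} := - (cis (- k))%:P; pose c2 : {poly R[i]} := - (cis k)%:P.
have c12 : c1 * c2 = 1.
  rewrite /c1 /c2 mulrNN -polyCM /cis cosN sinN.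
  congr (_%:P); apply/eqP; rewrite eq_complex /=; apply/andP; split; apply/eqP.
    by rewrite mulNr opprK -!expr2 cos2Dsin2.
  by ring.
have cD : c1 + c2 = - phi (2 * cos k)%:P.
  rewrite phiC /c1 /c2 -opprD -polyCD; congr (- (_%:P)).
  rewrite /cis cosN sinN; apply/eqP; rewrite eq_complex /=.
  by apply/andP; split; apply/eqP; ring.
have E : char_poly_mx (floquet_mx V q k) = periodic_jacobi_mx d c1 c2 q.
  apply/matrixP => i j; rewrite !mxE /c1 /c2.
  have -> : d i = 'X - (real_complex R (V i))%:P := phiX _.
  rewrite !polyCD !polyCMn.
  by rewrite polyC1; ring.
rewrite /char_poly E; case: q q2 E => [|[|[|r]]] // _ E.
have [e H] := det_periodic_jacobi d r c12.
have F : continuant d r.+3 - continuant2 d r.+2 + c1 + c2 =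
   phi (discriminant V r.+3 - (2 * cos k)%:P).
  by rewrite -addrA cD /d -rmorph_continuant -rmorph_continuant2 !rmorphB.
have [m _] := @discriminant_subC_monic V r.+3 (2 * cos k) isT.
(* The sign left open by [det_periodic_jacobi] is fixed here: a minus sign would contradict that
   both polynomials are monic. *)
rewrite H F; case: e H => H; last by rewrite mul1r.
have := char_poly_monic (floquet_mx V r.+3 k).
rewrite /char_poly E H F expr1 mulN1r monicE lead_coefN.
have mphi : phi (discriminant V r.+3 - (2 * cos k)%:P) \is monic by exact: monic_map.
move: mphi; rewrite monicE => /eqP -> /eqP/(congr1 (@complex.Re R)) /= N1.
by exfalso; move: N1; lra.
Qed.

(** For a left eigenvector [v], the quadratic form of [M] at [v] equals [z] times the squared norm
    of [v], and both numbers are their own conjugates. *)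
Lemma hermitian_root_real q (M : 'M[R[i]]_q) (z : R[i]) :
  (forall i j, M j i = conjc (M i j)) -> root (char_poly M) z -> complex.Im z = 0.
Proof.
move=> herm; rewrite -eigenvalue_root_char => /eigenvalueP[v vM v0].
pose N := \sum_j v 0 j * conjc (v 0 j).
pose S := \sum_i \sum_j v 0 i * M i j * conjc (v 0 j).
have S1 : S = z * N.
  rewrite /S exchange_big /= mulr_sumr; apply: eq_bigr => j _.
  rewrite -mulr_suml mulrA; congr (_ * _).
  by have := congr1 (fun w : 'rV_q => w 0 j) vM; rewrite !mxE.
have S2 : conjc S = S.
  rewrite /S [RHS]exchange_big rmorph_sum; apply: eq_bigr => i _.
  rewrite rmorph_sum; apply: eq_bigr => j _.
  by rewrite !rmorphM /= conjcK -herm; ring.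
have N2 : conjc N = N.
  by rewrite /N rmorph_sum; apply: eq_bigr => i _; rewrite rmorphM /= conjcK mulrC.
have N0 : N != 0.
  have ge0 j : 0 <= v 0 j * conjc (v 0 j) by exact: mul_conjC_ge0.
  apply: contra v0; rewrite /N psumr_eq0 // => /allP H.
  apply/eqP/rowP => j; rewrite mxE; apply/eqP.
  have := H j (mem_index_enum j); rewrite /= mulf_eq0 => /orP[//|].
  by rewrite conjc_eq0.
have : conjc z = z.
  have : conjc (z * N) = z * N by rewrite -S1.
  by rewrite rmorphM /= N2 => /(mulIf N0).
by case: z {vM S1} => a b /= [] /eqP; rewrite eq_sym -subr_eq0 opprK -mulr2n mulrn_eq0 => /eqP.
Qed.

Lemma floquet_hermitian V q k i j :
  floquet_mx V q k j i = conjc (floquet_mx V q k i j).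
Proof.
have cN x : (cos x -i* sin x)%C = cis (- x) :> R[i] by rewrite /cis cosN sinN.
have cR (x : R) : (x -i* 0)%C = real_complex R x by rewrite oppr0.
rewrite !mxE !rmorphD !rmorphMn /= !cN !cR opprK.
rewrite (_ : (j == i) = (i == j)); last by rewrite eq_sym.
rewrite orbC (andbC (j == 0%N :> nat)) (andbC (j.+1 == q)) -!addrA.
rewrite [X in _ = _ + (_ + X)]addrC.
by congr (_ + (_ + _)); case: eqP => [->|].
Qed.

(** All roots are real, so taking real parts and sorting keeps the factorization, which descends to
    real polynomials by injectivity of the embedding into [R[i]]. *)
Lemma discriminant_eigenvalues V q k : (2 < q)%N ->
  discriminant V q - (2 * cos k)%:P =
    \prod_(x <- eigenvalues (floquet_mx V q k)) ('X - x%:P) /\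
  size (eigenvalues (floquet_mx V q k)) = q.
Proof.
move=> q2; set M := floquet_mx V q k.
rewrite /eigenvalues; case: closed_field_poly_normal => rs /= E.
have H z : z \in rs -> z = real_complex R (complex.Re z).
  move=> zrs; have rz : root (char_poly M) z.
    by rewrite E rootZ ?root_prod_XsubC // lead_coef_eq0 monic_neq0 // char_poly_monic.
  have := hermitian_root_real (@floquet_hermitian V q k) rz.
  by case: z {zrs rz} => a b /= ->.
move: (char_poly_monic M); rewrite monicE => /eqP M1; rewrite M1 scale1r in E.
have E2 : discriminant V q - (2 * cos k)%:P =
    \prod_(x <- [seq complex.Re z | z <- rs]) ('X - x%:P).
  apply: (@map_poly_inj _ _ (real_complex R)); rewrite -char_poly_floquet // E.
  rewrite rmorph_prod big_map; apply: eq_big_seq => z zrs.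
  by rewrite /= map_polyXsubC {1}(H z zrs).
have [_] := discriminant_subC_monic V (2 * cos k) q2.
rewrite E2 size_prod_XsubC size_sort => -[->]; split=> //.
by apply: perm_big; rewrite perm_sym perm_sort.
Qed.

End Discriminant.

(** * Derivative of the discriminant at its zeros *)

Section BandDerivative.
Variable R : realType.
Implicit Types (s : seq R) (e B : R).

Lemma horner_prod_XsubC s e :
  (\prod_(x <- s) ('X - x%:P)).[e] = \prod_(x <- s) (e - x).
Proof. by rewrite horner_prod; apply: eq_bigr => x _; rewrite hornerXsubC. Qed.

Lemma deriv_prod_XsubC s e : e \notin s ->
  (\prod_(x <- s) ('X - x%:P))^`().[e] =
  (\prod_(x <- s) (e - x)) * \sum_(x <- s) (e - x)^-1.
Proof.
elim: s => [|a s IH] es; first by rewrite !big_nil derivC hornerC mulr0.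
move: es; rewrite inE negb_or => /andP[ea es].
rewrite !big_cons derivM derivXsubC mul1r hornerD hornerM hornerXsubC IH //.
rewrite horner_prod_XsubC.
have : e - a != 0 by rewrite subr_eq0.
by move=> ?; field.
Qed.

(** Each factor is [1 + (g - e) / (e - x)], at most the exponential of [(g - e) / (e - x)];
    nonnegativity allows multiplying these bounds. *)
Lemma prod_ratio_le_exp s e g : e \notin s ->
  (forall x, x \in s -> 0 <= (g - x) / (e - x)) ->
  \prod_(x <- s) ((g - x) / (e - x)) <= expR ((g - e) * \sum_(x <- s) (e - x)^-1).
Proof.
move=> es H; rewrite mulr_sumr expR_sum !big_seq; apply: ler_prod => x xs.
rewrite H //=; apply: le_trans (expR_ge1Dx _).
have ex : e - x != 0 by rewrite subr_eq0; apply: contra es => /eqP ->.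
by rewrite le_eqVlt; apply/orP; left; apply/eqP; field.
Qed.

(** From [exp (- 1/4) >= 3/4] one gets [exp (1/2) <= 16/9]. This serves as [log 2 > 1/2]. *)
Lemma expR_half_lt2 : expR (2^-1 : R) < 2.
Proof.
have E : expR (2^-1 : R) = (expR (- 4^-1) ^+ 2)^-1.
  by rewrite -expRM_natl -expRN; congr expR; field.
have H : 3 / 4 <= expR (- 4^-1 : R).
  by apply: le_trans (expR_ge1Dx _); lra.
by rewrite E invf_plt ?posrE ?exprn_gt0 ?expR_gt0 //; nra.
Qed.

Lemma mulr_lt0_between (e a b : R) :
  (e - a) * (e - b) < 0 -> (e < a /\ b < e) \/ (e < b /\ a < e).
Proof.
have [ea|ae] := ltP e a => H; [left|right].
  by split=> //; nra.
split; first by nra.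
by rewrite lt_neqAle ae andbT; apply: contraTneq H => ->; rewrite subrr mul0r ltxx.
Qed.

(** With [p] the product, no root lies between [e] and [g], so all ratios are nonnegative and
    [2 <= exp ((g - e) p'(e) / p(e))]. Since [log 2 > 1/2], the logarithmic derivative at [e]
    exceeds [1 / (2 (g - e))]. *)
Lemma doubling_derivative s e g : e \notin s -> e < g ->
  (forall x, x \in s -> ~~ (e < x < g)) ->
  \prod_(x <- s) (g - x) = 2 * \prod_(x <- s) (e - x) ->
  `|\prod_(x <- s) (e - x)| <=
    2 * (g - e) * `|(\prod_(x <- s) ('X - x%:P))^`().[e]|.
Proof.
move=> es eg H D; rewrite deriv_prod_XsubC // normrM.
set p := \prod_(x <- s) (e - x) in D *; set S := \sum_(x <- s) _.
have p0 : p != 0.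
  rewrite /p prodf_seq_neq0; apply/allP => x xs /=.
  by rewrite subr_eq0; apply: contra es => /eqP ->.
have : 2 <= expR ((g - e) * S).
  have <- : \prod_(x <- s) ((g - x) / (e - x)) = 2.
    by rewrite big_split /= prodfV D mulfK.
  apply: prod_ratio_le_exp => // x xs; have := H x xs.
  have ex : e != x by apply: contra es => /eqP ->.
  rewrite negb_and -!leNgt => /orP[xe|gx].
    by rewrite divr_ge0 // subr_ge0 // (le_trans xe) // ltW.
  by rewrite -mulrNN -invrN !opprB divr_ge0 // subr_ge0 // (le_trans (ltW eg)).
move=> h2; have hS : 2^-1 < (g - e) * S.
  by rewrite -ltr_expR; apply: lt_le_trans h2; exact: expR_half_lt2.
have S0 : 0 < S by nra.
rewrite (gtr0_norm S0).
have := normr_ge0 p; nra.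
Qed.

Lemma seq_min s : s != [::] -> exists2 g, g \in s & forall x, x \in s -> g <= x.
Proof.
elim: s => // a s IH _; have [->|/IH[g gs gm]] := eqVneq s [::].
  by exists a; rewrite ?mem_head // => x; rewrite inE => /eqP ->.
have [ag|ga] := leP a g.
  exists a; first exact: mem_head.
  by move=> x; rewrite inE => /orP[/eqP ->//|/gm]; exact: le_trans.
exists g; first by rewrite inE gs orbT.
by move=> x; rewrite inE => /orP[/eqP ->|/gm//]; exact: ltW.
Qed.

Lemma band_derivative (f : {poly R}) (al be : seq R) e B :
  f - 2%:P = \prod_(x <- al) ('X - x%:P) ->
  f + 2%:P = \prod_(x <- be) ('X - x%:P) ->
  size al = size be ->
  (forall j, (j < size al)%N -> `|nth 0 al j - nth 0 be j| <= B) ->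
  f.[e] = 0 -> 1 <= B * `|f^`().[e]|.
Proof.
move=> fal fbe sz HB fe.
have pal y : \prod_(x <- al) (y - x) = f.[y] - 2.
  by rewrite -horner_prod_XsubC -fal !hornerE.
have pbe y : \prod_(x <- be) (y - x) = f.[y] + 2.
  by rewrite -horner_prod_XsubC -fbe !hornerE.
have root_s s y : y \in s -> \prod_(x <- s) (y - x) = 0 :> R.
  by move=> ys; rewrite (big_rem y) //= subrr mul0r.
have eal : e \notin al.
  by apply/negP => /root_s; rewrite pal fe; lra.
have ebe : e \notin be.
  by apply/negP => /root_s; rewrite pbe fe; lra.
(* The product of [f - 2] and [f + 2] at [e] is -4, so pairing the edges by index, some pair
   contributes a negative factor: [e] lies strictly between its two members. *)
have [j jq jneg] : exists2 j, (j < size al)%N & (e - nth 0 al j) * (e - nth 0 be j) < 0.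
  apply: contrapT => nex.
  have : 0 <= \prod_(0 <= j < size al) ((e - nth 0 al j) * (e - nth 0 be j)).
    rewrite big_nat; apply: prodr_ge0 => j /= jq; rewrite leNgt; apply/negP => jn.
    by apply: nex; exists j.
  rewrite big_split /= {2}sz -!(big_nth 0 predT (fun x => e - x)) pal pbe fe; lra.
(* The first edge to the right of [e]; it is at most the right edge of band [j], hence within
   distance [B] of [e]. *)
have [g gs gm] : exists2 g, g \in [seq x <- al ++ be | e < x]
    & forall x, x \in [seq x <- al ++ be | e < x] -> g <= x.
  apply: seq_min; apply/eqP => E.
  have [h|h] : e < nth 0 al j \/ e < nth 0 be j.
    by have [[]|[]] := mulr_lt0_between jneg; [left|right].
  - have : nth 0 al j \in [seq x <- al ++ be | e < x].
      by rewrite mem_filter h mem_cat mem_nth.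
    by rewrite E.
  - have : nth 0 be j \in [seq x <- al ++ be | e < x].
      by rewrite mem_filter h mem_cat mem_nth ?orbT // -sz.
    by rewrite E.
have gB : g - e <= B.
  have := HB j jq; rewrite ler_norml => /andP[h1 h2].
  have [h|h] := mulr_lt0_between jneg.
  - have : g <= nth 0 al j by apply: gm; rewrite mem_filter h.1 mem_cat mem_nth.
    by lra.
  - have : g <= nth 0 be j.
      by apply: gm; rewrite mem_filter h.1 mem_cat mem_nth ?orbT // -sz.
    by lra.
move: gs; rewrite mem_filter mem_cat => /andP[eg gs].
have no_mid x : (x \in al) || (x \in be) -> ~~ (e < x < g).
  move=> xs; apply/negP => /andP[ex xg].
  have := gm x; rewrite mem_filter ex mem_cat xs => /(_ isT).
  by rewrite leNgt xg.
have fd c : (f + c%:P)^`() = f^`() by rewrite derivD derivC addr0.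
suff : 2 <= 2 * (g - e) * `|f^`().[e]| by have := normr_ge0 f^`().[e]; nra.
(* If [g] is a zero of [f - 2], then [f + 2] passes from 2 at [e] to 4 at [g]; otherwise [f - 2]
   passes from -2 to -4. Either way a product without roots in between doubles. *)
case/orP: gs => gs.
  have fg : f.[g] = 2 by have := root_s _ _ gs; rewrite pal; lra.
  have := @doubling_derivative be e g ebe eg.
  rewrite -fbe fd !pbe fe fg add0r ger0_norm //; apply; last by lra.
  by move=> x xb; apply: no_mid; rewrite xb orbT.
have fg : f.[g] = - 2 by have := root_s _ _ gs; rewrite pbe; lra.
have := @doubling_derivative al e g eal eg.
rewrite -fal -polyCN fd !pal fe fg add0r normrN ger0_norm //; apply; last by lra.
by move=> x xb; apply: no_mid; rewrite xb.
Qed.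

Lemma simple_roots_uniq s :
  (forall x, x \in s -> (\prod_(y <- s) ('X - y%:P))^`().[x] != 0) -> uniq s.
Proof.
elim: s => // a s IH H /=.
have D x : (\prod_(y <- a :: s) ('X - y%:P))^`().[x] =
    \prod_(y <- s) (x - y) + (x - a) * (\prod_(y <- s) ('X - y%:P))^`().[x].
  by rewrite big_cons derivM derivXsubC mul1r hornerD hornerM hornerXsubC horner_prod_XsubC.
have root_s y : y \in s -> \prod_(x <- s) (y - x) = 0 :> R.
  by move=> ys; rewrite (big_rem y) //= subrr mul0r.
apply/andP; split.
  apply/negP => as_; have := H a (mem_head _ _).
  by rewrite D root_s // subrr mul0r addr0 eqxx.
apply: IH => x xs; have := H x; rewrite inE xs orbT => /(_ isT).
by rewrite D root_s // add0r mulf_eq0 negb_or => /andP[].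
Qed.

End BandDerivative.

(** * Partial fractions of the inverse discriminant and the norm of the kernel *)

Section Nodes.
Variables (R : realType) (q : nat) (e : 'I_q -> R).

Definition node_poly : {poly R} := \prod_j ('X - (e j)%:P).
Definition node_cofactor l : {poly R} := \prod_(j | j != l) ('X - (e j)%:P).
(** The residue of the inverse of [node_poly] at [e l]. *)
Definition node_weight l : R := (node_poly^`().[e l])^-1.

Lemma node_polyE l : node_poly = ('X - (e l)%:P) * node_cofactor l.
Proof. by rewrite /node_poly (bigD1 l). Qed.

Lemma deriv_node_poly l : node_poly^`().[e l] = (node_cofactor l).[e l].
Proof.
rewrite (node_polyE l) derivM derivXsubC mul1r hornerD hornerM hornerXsubC subrr.
by rewrite mul0r addr0.
Qed.

Lemma size_node_cofactor l : size (node_cofactor l) = q.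
Proof.
rewrite /node_cofactor -big_filter size_prod_XsubC.
by rewrite -sum1_size big_filter sum1_card cardC1 card_ord; case: q l => [[]|].
Qed.

Hypothesis e_inj : injective e.

Lemma node_weight_neq0 l : node_weight l != 0.
Proof.
rewrite invr_neq0 // deriv_node_poly horner_prod prodf_seq_neq0.
apply/allP => j _; apply/implyP => jl; rewrite hornerXsubC subr_eq0.
by apply: contra jl => /eqP /e_inj ->.
Qed.

(** The difference of the two sides has degree less than [q] and vanishes at the [q] distinct
    nodes. *)
Lemma lagrange_one : (0 < q)%N -> \sum_l node_weight l *: node_cofactor l = 1.
Proof.
move=> q0; apply/eqP; rewrite -subr_eq0; apply/eqP.
apply: (@roots_geq_poly_eq0 _ _ [seq e j | j <- enum 'I_q]).
- apply/allP => _ /mapP[j _ ->]; rewrite /root !hornerE horner_sum (bigD1 j) //=.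
  rewrite hornerZ big1 ?addr0.
    rewrite -deriv_node_poly mulVf ?subrr //.
    by have := node_weight_neq0 j; rewrite invr_eq0.
  move=> l lj; rewrite hornerZ horner_prod (bigD1 j) 1?eq_sym //=.
  by rewrite hornerXsubC subrr mul0r mulr0.
- by rewrite map_inj_uniq // enum_uniq.
- rewrite size_map size_enum_ord (leq_trans (size_polyD _ _)) // geq_max.
  rewrite size_polyN size_poly1 q0 andbT (leq_trans (size_sum _ _ _)) //.
  apply/bigmax_leqP => l _; rewrite (leq_trans (size_scale_leq _ _)) //.
  by rewrite size_node_cofactor.
Qed.

(** The squared modulus of [node_poly] at [x + i y]. *)
Definition node_normsq (x y : R) : R := \prod_j ((x - e j) ^+ 2 + y ^+ 2).

Lemma node_partial_fractions (z : R[i]) : (0 < q)%N ->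
  (forall j, z != real_complex R (e j)) ->
  \sum_l real_complex R (node_weight l) / (z - real_complex R (e l)) =
  (\prod_j (z - real_complex R (e j)))^-1.
Proof.
move=> q0 zE; have := congr1 (fun p => (map_poly (real_complex R) p).[z]) (lagrange_one q0).
rewrite /= rmorph1 hornerC rmorph_sum horner_sum /= => H.
rewrite -[RHS]mul1r -[X in _ = X * _]H mulr_suml; apply: eq_bigr => l _.
rewrite linearZ /= hornerZ -mulrA; congr (_ * _).
have -> : (map_poly (real_complex R) (node_cofactor l)).[z] =
    \prod_(j | j != l) (z - real_complex R (e j)).
  rewrite rmorph_prod horner_prod; apply: eq_bigr => j _.
  by rewrite /= map_polyXsubC hornerXsubC.
rewrite [X in _ = _ / X](bigD1 l) //= invfM [RHS]mulrCA mulfV ?mulr1 //.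
by apply/prodf_neq0 => j _; rewrite subr_eq0; exact: zE.
Qed.

Lemma sqr_normc_shift (x y c : R) :
  Normc.normc ((x +i* y)%C - real_complex R c) = Num.sqrt ((x - c) ^+ 2 + y ^+ 2).
Proof. by rewrite /= subr0. Qed.

Lemma normc_node_prod (x y : R) :
  Normc.normc (\prod_j ((x +i* y)%C - real_complex R (e j))) = Num.sqrt (node_normsq x y).
Proof.
rewrite /node_normsq (big_morph _ (@Normc.normcM R) (Normc.normc1 R)).
have -> : Num.sqrt (\prod_j ((x - e j) ^+ 2 + y ^+ 2)) =
          \prod_j Num.sqrt ((x - e j) ^+ 2 + y ^+ 2) :> R.
  have ge0 j : 0 <= (x - e j) ^+ 2 + y ^+ 2 by rewrite addr_ge0 ?sqr_ge0.
  elim: (index_enum _) => [|j s IH]; first by rewrite !big_nil sqrtr1.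
  by rewrite !big_cons sqrtrM // IH.
by apply: eq_bigr => j _; rewrite sqr_normc_shift.
Qed.

Lemma normc_sum (I : Type) (r : seq I) (F : I -> R[i]) :
  Normc.normc (\sum_(i <- r) F i) <= \sum_(i <- r) Normc.normc (F i).
Proof.
elim: r => [|i r IH]; first by rewrite !big_nil Normc.normc0.
by rewrite !big_cons (le_trans (le_normcD _ _)) // lerD2l.
Qed.

Lemma norm_Im_le_normc (z : R[i]) : `|complex.Im z| <= Normc.normc z.
Proof. by case: z => a b /=; rewrite -sqrtr_sqr ler_wsqrtr // lerDr sqr_ge0. Qed.

Lemma Im_sum (I : Type) (r : seq I) (F : I -> R[i]) :
  complex.Im (\sum_(i <- r) F i) = \sum_(i <- r) complex.Im (F i).
Proof. by apply: (big_morph (@complex.Im R)) => // -[a b] [c d]. Qed.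

Lemma shift_neq (x y c : R) : 0 < y -> (x +i* y)%C != real_complex R c.
Proof. by move=> y0; rewrite eq_complex /= negb_and (gt_eqF y0) orbT. Qed.

(** By partial fractions the sum is minus the imaginary part of the inverse of [node_poly] at
    [x + i y]. *)
Lemma node_resolvent_le (x y : R) : (0 < q)%N -> 0 < y ->
  `|\sum_l node_weight l * (y / (y ^+ 2 + (x - e l) ^+ 2))| <= (Num.sqrt (node_normsq x y))^-1.
Proof.
move=> q0 y0; rewrite -normc_node_prod -Normc.normcV -node_partial_fractions //; last first.
  by move=> j; exact: shift_neq.
apply: le_trans (norm_Im_le_normc _); rewrite Im_sum -normrN -sumrN.
rewrite le_eqVlt; apply/orP; left; apply/eqP; congr `|_|; apply: eq_bigr => l _ /=.
have D : y ^+ 2 + (x - e l) ^+ 2 != 0.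
  by rewrite gt_eqF // ltr_wpDr ?sqr_ge0 // exprn_gt0.
by rewrite !subr0 mul0r addr0; field; rewrite addrC D.
Qed.

Lemma node_normsq_inv_le (x y : R) : (0 < q)%N -> 0 < y ->
  (Num.sqrt (node_normsq x y))^-1 <= (\sum_l `|node_weight l|) / y.
Proof.
move=> q0 y0; rewrite -normc_node_prod -Normc.normcV -node_partial_fractions //; last first.
  by move=> j; exact: shift_neq.
rewrite (le_trans (normc_sum _ _)) // mulr_suml; apply: ler_sum => l _.
rewrite Normc.normcM Normc.normcV sqr_normc_shift.
have -> : Normc.normc (real_complex R (node_weight l)) = `|node_weight l|.
  by rewrite /= expr0n /= addr0 sqrtr_sqr.
rewrite ler_wpM2l // lef_pV2 ?posrE ?sqrtr_gt0.
- by rewrite -[leLHS]gtr0_norm // -sqrtr_sqr ler_wsqrtr // lerDr sqr_ge0.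
- by rewrite ltr_wpDl ?sqr_ge0 // exprn_gt0.
- by [].
Qed.

(* Comparing the heights [min (1, h) / 2] and [h] serves both for small and large [h]. *)
Lemma node_normsq_gain (j : 'I_q) (p : nat) (h : R) : 0 < h ->
  (2 * p <= #|[set l | (`|e j - e l| <= Num.min 1 h)%R]%SET|)%N ->
  ((8 / 5 * Num.max 1 h) ^+ p * Num.sqrt (node_normsq (e j) (Num.min 1 h / 2))) <=
  Num.sqrt (node_normsq (e j) h).
Proof.
move=> h0 card_l.
set c := Num.min 1 h in card_l *; set M := Num.max 1 h.
have c0 : 0 < c by rewrite /c lt_min ltr01.
have M1 : 1 <= M by rewrite /M le_max lexx.
have cM : c * M = h by rewrite /c /M; case: (leP 1 h) => _; rewrite ?mul1r ?mulr1.
have g1 : 1 <= 8 / 5 * M by lra.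
have fac l : (e j - e l) ^+ 2 + (c / 2) ^+ 2 <= (e j - e l) ^+ 2 + h ^+ 2.
  by rewrite lerD2l ler_sqr ?nnegrE ?divr_ge0 ?(ltW h0) ?(ltW c0) // -cM; nra.
have facC l : `|e j - e l| <= c ->
    (8 / 5 * M) * ((e j - e l) ^+ 2 + (c / 2) ^+ 2) <= (e j - e l) ^+ 2 + h ^+ 2.
  move=> dc; have : (e j - e l) ^+ 2 <= c ^+ 2.
    by rewrite -(real_normK (num_real _)) ler_sqr ?nnegrE // ltW.
  have := sqr_ge0 (e j - e l); rewrite -cM; set D := (e j - e l) ^+ 2 => D0 Dc.
  have e1 : 0 <= (8 / 5 * M - 1) * (c ^+ 2 - D) by apply: mulr_ge0; lra.
  have e2 : 0 <= (M - 1) ^+ 2 * c ^+ 2 by rewrite mulr_ge0 ?sqr_ge0.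
  (* The constant 8/5 is the worst ratio, reached at [M = 1] and [D = c ^ 2], where it is 2 divided
     by 5/4; this identity displays the excess as a sum of nonnegative terms. *)
  have e3 : D + (c * M) ^+ 2 - 8 / 5 * M * (D + (c / 2) ^+ 2) =
    (8 / 5 * M - 1) * (c ^+ 2 - D) + (M - 1) ^+ 2 * c ^+ 2 by field.
  by lra.
(* The cluster supplies at least [2 p] factors of the squared modulus, hence a power [p] after
   taking the square root; the remaining factors do not decrease. *)
have : ((8 / 5 * M) ^+ p) ^+ 2 * node_normsq (e j) (c / 2) <= node_normsq (e j) h.
  rewrite -exprM mulnC /node_normsq.
  apply: (@le_trans _ _ ((8 / 5 * M) ^+ #|[set l | (`|e j - e l| <= c)%R]%SET| *
      \prod_l ((e j - e l) ^+ 2 + (c / 2) ^+ 2))).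
    rewrite ler_wpM2r ?ler_weXn2l //.
    by apply: prodr_ge0 => l _; rewrite addr_ge0 ?sqr_ge0.
  rewrite -prodr_const big_mkcond -big_split /=; apply: ler_prod => l _.
  rewrite inE; case: ifP => [/facC ->|_]; rewrite ?mul1r ?fac ?andbT.
    by rewrite mulr_ge0 ?addr_ge0 ?sqr_ge0 //; lra.
  by rewrite addr_ge0 ?sqr_ge0.
rewrite -ler_sqrt; last by apply: prodr_ge0 => l _; rewrite addr_ge0 ?sqr_ge0.
rewrite sqrtrM ?sqr_ge0 // sqrtr_sqr ger0_norm //.
by rewrite exprn_ge0 //; lra.
Qed.

(** The integral of [exp (- h t) |k t| ^ 2] over the half line, evaluated term by term. The
    imaginary parts cancel by symmetry in [j] and [l]. *)
Definition node_gram (h : R) : R :=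
  \sum_j \sum_l node_weight j * node_weight l * (h / (h ^+ 2 + (e j - e l) ^+ 2)).

Lemma node_gram_le (h B : R) (p : nat) : (0 < q)%N -> 0 < h ->
  (forall l, `|node_weight l| <= B) ->
  (forall j, (2 * p <= #|[set l | (`|e j - e l| <= Num.min 1 h)%R]%SET|)%N) ->
  node_gram h <= 2 * q%:R ^+ 2 * B ^+ 2 / Num.min 1 h / (8 / 5 * Num.max 1 h) ^+ p.
Proof.
move=> q0 h0 HB card_l.
set c := Num.min 1 h; set G := (8 / 5 * _) ^+ p.
have c0 : 0 < c by rewrite /c lt_min ltr01.
have G0 : 0 < G by rewrite exprn_gt0 // mulr_gt0 // lt_max ltr01.
have sumB : \sum_l `|node_weight l| <= q%:R * B.
  rewrite -[q in X in _ <= X](card_ord q) mulr_natl -sumr_const.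
  by apply: ler_sum => l _.
have B0 : 0 <= B by apply: le_trans (HB (Ordinal q0)).
(* The inner sum is at most the inverse modulus of [node_poly] at height [h]; the gain transfers
   this to height [c / 2], where the crude bound is [q B] divided by [c / 2]. *)
have main j : `|\sum_l node_weight l * (h / (h ^+ 2 + (e j - e l) ^+ 2))| <= 2 * q%:R * B / c / G.
  apply: le_trans (node_resolvent_le _ q0 h0) _.
  have := node_normsq_gain h0 (card_l j); rewrite -/c -/G => gain.
  have c2 : 0 < c / 2 by rewrite divr_gt0.
  have := node_normsq_inv_le (e j) q0 c2.
  have N0 y : 0 < y -> 0 < Num.sqrt (node_normsq (e j) y).
    by move=> y0; rewrite sqrtr_gt0; apply: prodr_gt0 => l _; rewrite ltr_wpDl ?sqr_ge0 ?exprn_gt0.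
  move=> inv.
  apply: (@le_trans _ _ ((G * Num.sqrt (node_normsq (e j) (c / 2)))^-1)).
    by rewrite lef_pV2 ?posrE ?mulr_gt0 ?N0.
  rewrite invfM mulrC ler_pM2r ?invr_gt0 //.
  apply: le_trans inv _; rewrite invf_div.
  have -> : 2 * q%:R * B / c = q%:R * B * (2 / c) by ring.
  by rewrite ler_wpM2r // divr_ge0 // ltW.
rewrite /node_gram.
apply: (@le_trans _ _ (\sum_(j < q) B * (2 * q%:R * B / c / G))).
  apply: ler_sum => j _.
  under eq_bigr do rewrite -mulrA; rewrite -mulr_sumr.
  apply: le_trans (ler_norm _) _; rewrite normrM.
  by apply: ler_pM.
rewrite sumr_const card_ord -mulr_natl le_eqVlt; apply/orP; left; apply/eqP.
by field; rewrite !gt_eqF.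
Qed.

End Nodes.

(** * Power series solutions of the Schrodinger equation *)

Section DeriveTools.
Variable R : realType.
Implicit Types (f g : R -> R).

Lemma is_derive_add f g (x a b : R) : is_derive x 1 f a -> is_derive x 1 g b ->
  is_derive x 1 (fun t => f t + g t) (a + b).
Proof. by move=> ? ?; exact: is_deriveD. Qed.

Lemma is_derive_mul f g (x a b : R) : is_derive x 1 f a -> is_derive x 1 g b ->
  is_derive x 1 (fun t => f t * g t) (a * g x + f x * b).
Proof.
move=> Hf Hg; have := @is_deriveM _ _ f g x 1 a b Hf Hg.
by rewrite /GRing.scale /= addrC [g x * a]mulrC.
Qed.

Lemma is_derive_scale f (c x a : R) : is_derive x 1 f a ->
  is_derive x 1 (fun t => c * f t) (c * a).
Proof. by move=> ?; exact: is_deriveZ. Qed.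

Lemma is_derive_bigsum (I : Type) (r : seq I) (F : I -> R -> R) (D : I -> R) (x : R) :
  (forall i, is_derive x 1 (F i) (D i)) ->
  is_derive x 1 (fun t => \sum_(i <- r) F i t) (\sum_(i <- r) D i).
Proof.
move=> H; elim: r => [|i r IH].
  rewrite big_nil; under eq_fun do rewrite big_nil; exact: is_derive_cst.
by rewrite big_cons; under eq_fun do rewrite big_cons; exact: is_derive_add.
Qed.

Lemma le0_derive_nincr f (D : R -> R) (a b : R) : a <= b ->
  (forall x : R, is_derive x 1 f (D x)) ->
  (forall x, a <= x <= b -> D x <= 0) -> f b <= f a.
Proof.
move=> ab fD D0.
have fd x : derivable f x 1 by case: (fD x).
have fd1 (x : R) : derive1 f x = D x by rewrite derive1E; case: (fD x).
apply: (@ler0_derive1_nincr _ f a b _ _ _ a b) => // [x|].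
  by rewrite in_itv /= => /andP[ax xb]; rewrite fd1 D0 // (ltW ax) (ltW xb).
by apply: derivable_within_continuous => x _.
Qed.

Lemma is_derive_expRM (c x : R) : is_derive x 1 (fun t => expR (c * t)) (c * expR (c * x)).
Proof.
have L : is_derive x 1 (fun t : R => c * t) (c * 1).
  by apply: is_derive_scale; exact: is_derive_id.
have := @is_derive1_comp R (@expR R) (fun t => c * t) x _ _ (is_derive_expR _) L.
by rewrite mulr1 mulrC.
Qed.

End DeriveTools.

Section ExponentialSeries.
Variable R : realType.
Implicit Types (c d : nat -> R) (t x A M : R).

(** Geometric growth of the coefficients makes the exponential generating function [egf] entire, and
    is stable under the shift. *)
Definition exp_type c := exists A M : R, forall k, `|c k| <= A * M ^+ k.

Definition egf c t : R := limn (pseries (fun k => c k / k`!%:R) t).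

Lemma egf_norm_term A M c t k : (forall k, `|c k| <= A * M ^+ k) ->
  `|c k / k`!%:R * t ^+ k| <= A * exp_coeff (M * `|t|) k.
Proof.
move=> H; rewrite !normrM normfV normr_nat normrX /exp_coeff /=.
have -> : A * ((M * `|t|) ^+ k / k`!%:R) = A * M ^+ k / k`!%:R * `|t| ^+ k.
  by rewrite exprMn; ring.
by rewrite ler_wpM2r ?exprn_ge0 // ler_wpM2r ?invr_ge0.
Qed.

Lemma egf_cvg_norm A M c t : (forall k, `|c k| <= A * M ^+ k) ->
  cvgn [normed pseries (fun k => c k / k`!%:R) t].
Proof.
move=> H; apply: (@series_le_cvg _ _ (fun k => A * exp_coeff (M * `|t|) k)).
- by move=> n; exact: normr_ge0.
- by move=> n; exact: le_trans (normr_ge0 _) (@egf_norm_term A M c t n H).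
- by move=> n; exact: egf_norm_term.
- by apply: (@is_cvg_seriesZ _ _ A); exact: is_cvg_series_exp_coeff.
Qed.

Lemma egf_cvg c t : exp_type c -> cvgn (pseries (fun k => c k / k`!%:R) t).
Proof. by move=> [A [M H]]; apply: normed_cvg; exact: (@egf_cvg_norm A M). Qed.

Lemma egf_le A M c t : (forall k, `|c k| <= A * M ^+ k) ->
  `|egf c t| <= A * expR (M * `|t|).
Proof.
move=> H; have cn := @egf_cvg_norm A M c t H.
apply: le_trans (lim_series_norm cn) _.
have -> : A * expR (M * `|t|) = limn (series (fun k => A * exp_coeff (M * `|t|) k)).
  by rewrite lim_seriesZ //; exact: is_cvg_series_exp_coeff.
apply: lim_series_le => // [|n]; last exact: egf_norm_term.
by apply: (@is_cvg_seriesZ _ _ A); exact: is_cvg_series_exp_coeff.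
Qed.

Lemma exp_type_shift c : exp_type c -> exp_type (fun k => c k.+1).
Proof.
by move=> [A [M H]]; exists (A * M), M => k; have := H k.+1; rewrite exprS mulrA.
Qed.

Lemma exp_type_pos c : exp_type c ->
  exists A M : R, [/\ 0 <= A, 0 <= M & forall k, `|c k| <= A * M ^+ k].
Proof.
move=> [A [M H]]; exists `|A|, `|M|; split=> // k.
by apply: le_trans (H k) _; rewrite -normrX -normrM ler_norm.
Qed.

Lemma exp_type_add c d : exp_type c -> exp_type d -> exp_type (fun k => c k + d k).
Proof.
move=> /exp_type_pos[A [M [A0 M0 H]]] /exp_type_pos[A' [M' [A0' M0' H']]].
exists (A + A'), (M + M') => k; apply: le_trans (ler_normD _ _) _.
rewrite mulrDl lerD //; [apply: le_trans (H k) _|apply: le_trans (H' k) _].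
  by rewrite ler_wpM2l // lerXn2r ?nnegrE ?addr_ge0 // lerDl.
by rewrite ler_wpM2l // lerXn2r ?nnegrE ?addr_ge0 // lerDr.
Qed.

Lemma exp_type_bmul b c : (forall k, `|b k| <= 1) -> exp_type c ->
  exp_type (fun k => b k * c k).
Proof.
move=> b1 [A [M H]]; exists A, M => k; rewrite normrM.
by apply: le_trans (H k); rewrite ler_piMl.
Qed.

Lemma exp_type_scale x c : exp_type c -> exp_type (fun k => x * c k).
Proof.
move=> [A [M H]]; exists (`|x| * A), M => k.
by rewrite normrM -mulrA ler_wpM2l.
Qed.

(** Because of the factorials, termwise differentiation is the shift of coefficients. Convergence is
    checked at [|t| + 1], beyond the point of differentiation. *)
Lemma egf_derive c t : exp_type c -> is_derive t 1 (egf c) (egf (fun k => c k.+1) t).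
Proof.
move=> Hc.
have E d : pseries_diffs (fun k => d k / k`!%:R) = (fun k => d k.+1 / k`!%:R) :> (nat -> R).
  apply/funext => k; rewrite /pseries_diffs factS natrM.
  have : k.+1%:R != 0 :> R by [].
  have : k`!%:R != 0 :> R by rewrite pnatr_eq0 -lt0n fact_gt0.
  move: (k.+1%:R) (k`!%:R) (d k.+1) => x y z y0 x0.
  by field; rewrite x0 y0.
have := @pseries_snd_diffs R (fun k => c k / k`!%:R) (`|t| + 1) t.
rewrite !E /egf; apply.
- exact: egf_cvg.
- by apply: egf_cvg; exact: exp_type_shift.
- by apply: egf_cvg; do 2 apply: (@exp_type_shift (fun k => _)).
- by rewrite [ltRHS]ger0_norm ?addr_ge0 // ltrDl.
Qed.

Lemma egf_add c d t : exp_type c -> exp_type d ->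
  egf (fun k => c k + d k) t = egf c t + egf d t.
Proof.
move=> Hc Hd; rewrite /egf /pseries -lim_seriesD; try exact: egf_cvg.
congr (limn (series _)); apply/funext => k /=.
by rewrite !mulrDl.
Qed.

Lemma egf_scale x c t : exp_type c -> egf (fun k => x * c k) t = x * egf c t.
Proof.
move=> Hc; rewrite /egf /pseries -[RHS]/(x *: _) -lim_seriesZ; try exact: egf_cvg.
by congr (limn (series _)); apply/funext => k; rewrite -[RHS]/(x * _) !mulrA.
Qed.

Lemma egf0 c : egf c 0 = c 0%N.
Proof.
rewrite /egf /pseries; apply: cvg_lim => //; apply: cvg_near_cst.
exists 1%N => // -[|n] // _; rewrite /series /= big_nat_recl // big1 ?addr0.
  by rewrite expr0 mulr1 fact0 divr1.
by move=> i _; rewrite expr0n mulr0.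
Qed.

(* [quarter k = Re ((- i) ^ k)] and [quarter k.+1 = Im ((- i) ^ k)]. *)
Fixpoint quarter (k : nat) : R :=
  match k with 0 => 1 | 1 => 0 | k'.+2 => - quarter k' end.

Lemma quarter_le1 k : `|quarter k| <= 1.
Proof.
suff [//] : `|quarter k| <= 1 /\ `|quarter k.+1| <= 1.
by elim: k => [|k [IH1 IH2]]; rewrite /= ?normr1 ?normr0 ?normrN.
Qed.

(** Together with [wave_im], the real and imaginary parts of the sum of [c k (- i t) ^ k / k!], kept
    separate so that real calculus applies. *)
Definition wave_re c := egf (fun k => quarter k * c k).
Definition wave_im c := egf (fun k => quarter k.+1 * c k).

Let quarter_type c b : exp_type c -> exp_type (fun k => quarter (b + k) * c k).
Proof. by move=> Hc; apply: exp_type_bmul => // k; exact: quarter_le1. Qed.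

(** With the next lemma: the time derivative of a wave is [- i] times the wave of the shifted
    coefficients. *)
Lemma wave_re_derive c t : exp_type c ->
  is_derive t 1 (wave_re c) (wave_im (fun k => c k.+1) t).
Proof. by move=> Hc; apply: egf_derive; exact: (@quarter_type c 0). Qed.

Lemma wave_im_derive c t : exp_type c ->
  is_derive t 1 (wave_im c) (- wave_re (fun k => c k.+1) t).
Proof.
move=> Hc; apply: is_derive_eq; first by apply: egf_derive; exact: (@quarter_type c 1).
rewrite /wave_re -mulN1r -egf_scale; last by apply: (@quarter_type _ 0); exact: exp_type_shift.
by congr egf; apply/funext => k; rewrite /= mulN1r mulNr.
Qed.

Lemma wave_re_lin x c d t : exp_type c -> exp_type d ->
  wave_re (fun k => x * c k + d k) t = x * wave_re c t + wave_re d t.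
Proof.
move=> Hc Hd; have Hc' := @quarter_type c 0 Hc; have Hd' := @quarter_type d 0 Hd.
rewrite /wave_re -egf_scale // -egf_add //; last exact: exp_type_scale.
by congr egf; apply/funext => k; ring.
Qed.

Lemma wave_im_lin x c d t : exp_type c -> exp_type d ->
  wave_im (fun k => x * c k + d k) t = x * wave_im c t + wave_im d t.
Proof.
move=> Hc Hd; have Hc' := @quarter_type c 1 Hc; have Hd' := @quarter_type d 1 Hd.
rewrite /wave_im -egf_scale // -egf_add //; last exact: exp_type_scale.
by congr egf; apply/funext => k; ring.
Qed.

Lemma exp_type0 : exp_type (fun=> 0).
Proof. by exists 0, 0 => k; rewrite normr0 mul0r. Qed.

Lemma wave_re_zero t : wave_re (fun=> 0) t = 0.
Proof.
have := @wave_re_lin (-1) (fun=> 0) (fun=> 0) t exp_type0 exp_type0.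
by under [X in wave_re X _ = _]eq_fun do rewrite mulr0 addr0; move=> ->; ring.
Qed.

Lemma wave_im_zero t : wave_im (fun=> 0) t = 0.
Proof.
have := @wave_im_lin (-1) (fun=> 0) (fun=> 0) t exp_type0 exp_type0.
by under [X in wave_im X _ = _]eq_fun do rewrite mulr0 addr0; move=> ->; ring.
Qed.

Lemma wave_re_le A M c t : (forall k, `|c k| <= A * M ^+ k) ->
  `|wave_re c t| <= A * expR (M * `|t|).
Proof.
move=> H; apply: egf_le => k; rewrite normrM.
by apply: le_trans (H k); rewrite ler_piMl ?quarter_le1.
Qed.

Lemma wave_im_le A M c t : (forall k, `|c k| <= A * M ^+ k) ->
  `|wave_im c t| <= A * expR (M * `|t|).
Proof.
move=> H; apply: egf_le => k; rewrite normrM.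
by apply: le_trans (H k); rewrite ler_piMl ?quarter_le1.
Qed.

Lemma wave_re0 c : wave_re c 0 = c 0%N.
Proof. by rewrite /wave_re egf0 mul1r. Qed.

Lemma wave_im0 c : wave_im c 0 = 0.
Proof. by rewrite /wave_im egf0 mul0r. Qed.

End ExponentialSeries.

(** * Driven Schrodinger equations on the half line and their energy *)

Section Chains.
Variable R : realType.
Implicit Types (V u g : nat -> R) (c : nat -> nat -> R).

Definition jacobi_op V u : nat -> R := fun n =>
  u n.+1 + (if n is m.+1 then u m else 0) + V n * u n.

Definition site m : nat -> R := fun n => (n == m)%:R.

(* [c k] collects the coefficients of [(- i t) ^ k / k!] in a vector-valued
   power series solving [i psi' = H psi + source]. *)
Definition solution_family V (a : nat) g c :=
  forall k n, c k.+1 n = jacobi_op V (c k) n + g k * site a n.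

(** The bound in [k] makes every coordinate entire in time; the decay in [n] makes the flux through
    a distant site negligible. *)
Definition decaying_family c := exists A M : R,
  [/\ 0 <= A, 0 <= M & forall k n, `|c k n| <= A * M ^+ k * 2^-1 ^+ n].

(** The coefficients of the evolution started at site [m]. *)
Definition chain V m k : nat -> R := iter k (jacobi_op V) (site m).

Lemma decaying_family_exp_type c n : decaying_family c -> exp_type (fun k => c k n).
Proof.
move=> [A [M [A0 M0 H]]]; exists (A * 2^-1 ^+ n), M => k.
by apply: le_trans (H k n) _; rewrite mulrAC.
Qed.

Lemma solution_family_decay V a g c v : (forall n, `|V n| <= v) ->
  exp_type g -> (exists A, forall n, `|c 0%N n| <= A * 2^-1 ^+ n) ->
  solution_family V a g c -> decaying_family c.
Proof.
move=> Vv /exp_type_pos[G [L [G0 L0 Hg]]] [A0 H0] sol.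
pose P := (2^-1 : R) ^+ a.
have P0 : 0 < P by rewrite exprn_gt0.
have v0 : 0 <= v by apply: le_trans (Vv 0%N).
(* On the profile [2 ^ (- n)] the operator costs a factor at most [1/2 + 2 + v] and the source a
   factor 1, so [v + 4] suffices. Adding [L] lets [M ^ k] dominate the growth of [g], and [G / P]
   makes [A] absorb the source at site [a], where the profile is [P]. *)
pose A := `|A0| + G / P; pose M := L + v + 4.
have A00 : 0 <= A by rewrite addr_ge0 // divr_ge0 // ltW.
have M0 : 0 <= M by rewrite /M; lra.
exists A, M; split => //; elim=> [|k IH] n.
  rewrite expr0 mulr1; apply: le_trans (H0 n) _; rewrite ler_wpM2r ?exprn_ge0 //.
  by apply: le_trans (ler_norm _) _; rewrite lerDl divr_ge0 // ltW.
set Q := (2^-1 : R) ^+ n; have Q0 : 0 < Q by rewrite exprn_gt0.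
have AM0 : 0 <= A * M ^+ k by rewrite mulr_ge0 ?exprn_ge0.
have src : `|g k * site a n| <= A * M ^+ k * Q.
  rewrite /site; case: eqP => [na|_]; last first.
    by rewrite mulr0 normr0 mulr_ge0 // ltW.
  rewrite mulr1; apply: le_trans (Hg k) _.
  apply: (@le_trans _ _ (G / P * M ^+ k * P)).
    rewrite mulrAC divfK ?gt_eqF // ler_wpM2l // lerXn2r ?nnegrE //.
    by rewrite /M; lra.
  by rewrite /Q na -/P !ler_wpM2r ?exprn_ge0 ?(ltW P0) // lerDr.
have nb : `|c k n.+1 + (if n is m.+1 then c k m else 0)| <= (5 / 2) * (A * M ^+ k * Q).
  have h1 : `|c k n.+1| <= 2^-1 * (A * M ^+ k * Q).
    by apply: le_trans (IH n.+1) _; rewrite exprS -/Q mulrCA.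
  have h2 : `|if n is m.+1 then c k m else 0| <= 2 * (A * M ^+ k * Q).
    rewrite /Q; case: (n) => [|m]; first by rewrite normr0 !mulr_ge0 ?exprn_ge0.
    by apply: le_trans (IH m) _; rewrite exprS; lra.
  by apply: le_trans (ler_normD _ _) _; lra.
have Vb : `|V n * c k n| <= v * (A * M ^+ k * Q) by rewrite normrM ler_pM.
rewrite sol /jacobi_op; apply: le_trans (ler_normD _ _) _.
have := ler_normD (c k n.+1 + (if n is m.+1 then c k m else 0)) (V n * c k n).
rewrite exprS; have -> : A * (M * M ^+ k) * Q = M * (A * M ^+ k * Q) by ring.
have : 0 <= A * M ^+ k * Q by rewrite mulr_ge0 // ltW.
move: (A * M ^+ k * Q) src nb Vb => Z src nb Vb Z0 tri.
have : M * Z = L * Z + v * Z + 4 * Z by rewrite /M; ring.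
have : 0 <= L * Z by rewrite mulr_ge0.
lra.
Qed.

Lemma chain_solution V m : solution_family V 0 (fun=> 0) (chain V m).
Proof. by move=> k n; rewrite mul0r addr0. Qed.

Lemma site_decay m : exists A : R, forall n, `|site m n| <= A * 2^-1 ^+ n.
Proof.
exists (2 ^+ m) => n; rewrite /site; case: eqP => [->|_].
  by rewrite normr1 -exprMn mulfV // expr1n.
by rewrite normr0 mulr_ge0 ?exprn_ge0.
Qed.

Lemma chain_decay V m v : (forall n, `|V n| <= v) -> decaying_family (chain V m).
Proof.
move=> Vv; apply: (solution_family_decay Vv (exp_type0 R) _ (@chain_solution V m)).
exact: site_decay.
Qed.

Section Waves.
Variables (V : nat -> R) (a : nat) (g : nat -> R) (c : nat -> nat -> R).
Hypotheses (cdec : decaying_family c) (gexp : exp_type g)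
  (csol : solution_family V a g c).

Let X n := wave_re (fun k => c k n).
Let Y n := wave_im (fun k => c k n).

(** This and the next lemma are the two components of [i psi' = H psi + g delta_a]. *)
Lemma solution_wave_re_derive n (t : R) :
  is_derive t 1 (X n) (jacobi_op V (Y^~ t) n + wave_im g t * site a n).
Proof.
apply: is_derive_eq; first by apply: wave_re_derive; exact: decaying_family_exp_type.
have ce m := decaying_family_exp_type m cdec.
transitivity (wave_im (fun k => 1 * c k n.+1 + (1 * (if n is m.+1 then c k m else 0)
   + (V n * c k n + (site a n * g k + 0)))) t).
  congr (wave_im _ t); apply/funext => k; rewrite csol /jacobi_op; case: n => [|n] /=; ring.
have e1 : exp_type (fun k => site a n * g k + 0).
  by apply: exp_type_add; [exact: exp_type_scale|exact: exp_type0].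
have e2 : exp_type (fun k => V n * c k n + (site a n * g k + 0)).
  by apply: exp_type_add => //; exact: exp_type_scale.
have e3 : exp_type (fun k => if n is m.+1 then c k m else 0).
  by case: n {e1 e2} => [|n]; [exact: exp_type0|].
have e4 : exp_type (fun k => 1 * (if n is m.+1 then c k m else 0)
   + (V n * c k n + (site a n * g k + 0))).
  by apply: exp_type_add => //; exact: exp_type_scale.
have e0 := exp_type0 R.
have W0 := wave_im_zero t.
rewrite !wave_im_lin // W0 /jacobi_op /Y; case: n {e1 e2 e3 e4} => [|n]; rewrite ?W0; ring.
Qed.

Lemma solution_wave_im_derive n (t : R) :
  is_derive t 1 (Y n) (- (jacobi_op V (X^~ t) n + wave_re g t * site a n)).
Proof.
apply: is_derive_eq; first by apply: wave_im_derive; exact: decaying_family_exp_type.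
congr (- _).
have ce m := decaying_family_exp_type m cdec.
transitivity (wave_re (fun k => 1 * c k n.+1 + (1 * (if n is m.+1 then c k m else 0)
   + (V n * c k n + (site a n * g k + 0)))) t).
  congr (wave_re _ t); apply/funext => k; rewrite csol /jacobi_op; case: n => [|n] /=; ring.
have e1 : exp_type (fun k => site a n * g k + 0).
  by apply: exp_type_add; [exact: exp_type_scale|exact: exp_type0].
have e2 : exp_type (fun k => V n * c k n + (site a n * g k + 0)).
  by apply: exp_type_add => //; exact: exp_type_scale.
have e3 : exp_type (fun k => if n is m.+1 then c k m else 0).
  by case: n {e1 e2} => [|n]; [exact: exp_type0|].
have e4 : exp_type (fun k => 1 * (if n is m.+1 then c k m else 0)
   + (V n * c k n + (site a n * g k + 0))).
  by apply: exp_type_add => //; exact: exp_type_scale.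
have e0 := exp_type0 R.
have W0 := wave_re_zero t.
rewrite !wave_re_lin // W0 /jacobi_op /X; case: n {e1 e2 e3 e4} => [|n]; rewrite ?W0; ring.
Qed.

Lemma solution_wave_decay t0 : exists A : R, forall n s, 0 <= s <= t0 ->
  `|X n s| <= A * 2^-1 ^+ n /\ `|Y n s| <= A * 2^-1 ^+ n.
Proof.
have [A [M [A0 M0 H]]] := cdec; exists (A * expR (M * t0)) => n s /andP[s0 st].
have E : A * 2^-1 ^+ n * expR (M * `|s|) <= A * expR (M * t0) * 2^-1 ^+ n.
  rewrite mulrAC ler_wpM2r ?exprn_ge0 // ler_wpM2l // ler_expR ler_wpM2l //.
  by rewrite ger0_norm.
have Hn k : `|c k n| <= A * 2^-1 ^+ n * M ^+ k by rewrite mulrAC.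
by split; apply: le_trans E; [apply: wave_re_le|apply: wave_im_le].
Qed.

(** The sum telescopes, and the left end contributes nothing because of the boundary condition. *)
Lemma green_identity (x y : nat -> R) N :
  \sum_(n < N.+1) (x n * jacobi_op V y n - y n * jacobi_op V x n) =
  x N * y N.+1 - y N * x N.+1.
Proof.
elim: N => [|N IH]; first by rewrite big_ord1 /jacobi_op /=; ring.
by rewrite big_ord_recr /= IH /jacobi_op; ring.
Qed.

Definition energy N t := \sum_(n < N) (X n t ^+ 2 + Y n t ^+ 2).

(** Mass in the window changes only through the source, which lies inside since [a <= N], and
    through the flux at its right end. *)
Lemma energy_derive N (t : R) : (a <= N)%N -> is_derive t 1 (energy N.+1)
  (2 * (X a t * wave_im g t - Y a t * wave_re g t)
   + 2 * (X N t * Y N.+1 t - Y N t * X N.+1 t)).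
Proof.
move=> aN; apply: is_derive_eq.
  apply: is_derive_bigsum => n; apply: is_derive_add.
    exact: is_derive_mul (solution_wave_re_derive n t) (solution_wave_re_derive n t).
  exact: is_derive_mul (solution_wave_im_derive n t) (solution_wave_im_derive n t).
rewrite -(green_identity (X^~ t) (Y^~ t)) -mulrDr.
transitivity (2 * \sum_(n < N.+1)
  ((X n t * jacobi_op V (Y^~ t) n - Y n t * jacobi_op V (X^~ t) n)
   + (X n t * wave_im g t - Y n t * wave_re g t) * site a n)).
  by rewrite mulr_sumr; apply: eq_bigr => n _; ring.
rewrite big_split /= addrC; congr (2 * (_ + _)).
have aN' : (a < N.+1)%N by [].
have sa : site a a = 1 by rewrite /site eqxx.
rewrite (bigD1 (Ordinal aN')) //= sa mulr1 big1 ?addr0 // => n na.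
by rewrite /site (_ : (n == a :> nat) = false) ?mulr0 //; apply/negbTE.
Qed.

(** A Gronwall argument: the source adds at most [c0] times the energy plus [S exp (c0 s)], and the
    flux disappears as the window grows. The hypothesis on [g] is written with [c0 S] so that
    [c0 = 0] is allowed, which is the case of no source. *)
Lemma energy_bound (c0 S E0 : R) : 0 <= c0 -> 0 <= S ->
  (forall s : R, 0 <= s ->
     wave_re g s ^+ 2 + wave_im g s ^+ 2 <= c0 * S * expR (c0 * s)) ->
  (forall N, energy N 0 <= E0) ->
  forall N (t : R), 0 <= t -> energy N t <= (E0 + S * t) * expR (c0 * t).
Proof.
move=> c00 S0 Hg HE N0 t t0.
have [A HA] := solution_wave_decay t.
have mono N N' : (N <= N')%N -> energy N t <= energy N' t.
  move=> NN; rewrite /energy -(subnKC NN) big_split_ord /= lerDl.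
  by apply: sumr_ge0 => i _; rewrite addr_ge0 ?sqr_ge0.
apply/ler_addgt0Pr => eps eps0.
(* The window is chosen so large that the total contribution of the flux stays below [eps]. *)
have [N [aN N0N small]] : exists N, [/\ (a <= N)%N, (N0 <= N.+1)%N &
    4 * A ^+ 2 * 2^-1 ^+ N * t * expR (c0 * t) <= eps].
  pose K := 4 * A ^+ 2 * t * expR (c0 * t) / eps.
  have K0 : 0 <= K.
    by rewrite divr_ge0 ?(ltW eps0) // !(sqr_ge0, expR_ge0, mulr_ge0).
  pose N := (a + N0 + Num.bound K)%N.
  exists N; split; [by rewrite /N; lia|by rewrite /N; lia|].
  have -> : 4 * A ^+ 2 * 2^-1 ^+ N * t * expR (c0 * t) = K * eps / 2 ^+ N.
    by rewrite divfK ?gt_eqF // exprVn; ring.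
  rewrite ler_pdivrMr ?exprn_gt0 // mulrC ler_pM2l //.
  apply: le_trans (ltW (archi_boundP K0)) _; rewrite -natrX ler_nat.
  apply: leq_trans (_ : N <= _)%N; first by rewrite /N; lia.
  exact: ltnW (ltn_expl _ _).
apply: le_trans (mono _ _ N0N) _.
pose err := 4 * A ^+ 2 * 2^-1 ^+ N.
(* The energy with its integrating factor, minus the linear growth allowed; the derivative of [phi]
   is nonpositive. *)
pose phi s := expR (- c0 * s) * energy N.+1 s + - (S + err) * s.
have : phi t <= phi 0.
  apply: (@le0_derive_nincr _ _ (fun s => - c0 * expR (- c0 * s) * energy N.+1 s
      + expR (- c0 * s) * (2 * (X a s * wave_im g s - Y a s * wave_re g s)
      + 2 * (X N s * Y N.+1 s - Y N s * X N.+1 s)) + - (S + err) * 1) _ _ t0)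
      => [s|s /andP[s0 st]].
    apply: is_derive_add.
      exact: is_derive_mul (is_derive_expRM (- c0) s) (energy_derive s aN).
  rewrite mulr1.
  set Z := expR (- c0 * s); set W := expR (c0 * s).
  have Z0 : 0 < Z by exact: expR_gt0.
  have ZW : Z * W = 1 by rewrite /Z /W -expRD mulNr addNr expR0.
  have Z1 : Z <= 1.
    by rewrite /Z -expR0 ler_expR mulNr oppr_le0 mulr_ge0.
  set D := X a s * wave_im g s - Y a s * wave_re g s.
  set F := X N s * Y N.+1 s - Y N s * X N.+1 s.
  have U : X a s ^+ 2 + Y a s ^+ 2 <= energy N.+1 s.
    have aN' : (a < N.+1)%N by [].
    rewrite /energy (bigD1 (Ordinal aN')) //= lerDl.
    by apply: sumr_ge0 => i _; rewrite addr_ge0 ?sqr_ge0.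
  (* Cauchy-Schwarz followed by the inequality of arithmetic and geometric means, arranged without
     dividing by [c0]. *)
  have h1 : 2 * D <= c0 * (X a s ^+ 2 + Y a s ^+ 2) + S * W.
    have g2 := Hg s s0; rewrite -/W in g2.
    have W0 : 0 <= W by exact: expR_ge0.
    set u := _ + _ in g2; set w := X a s ^+ 2 + _.
    have w0 : 0 <= w by rewrite addr_ge0 ?sqr_ge0.
    have cs : D ^+ 2 <= w * u.
      rewrite -subr_ge0 (_ : _ - _ =
        (X a s * wave_re g s + Y a s * wave_im g s) ^+ 2) ?sqr_ge0 //.
      by rewrite /w /u /D; ring.
    have SW0 : 0 <= c0 * w + S * W by rewrite addr_ge0 ?mulr_ge0.
    apply: le_trans (ler_norm _) _.
    rewrite -(ger0_norm SW0) -ler_sqr ?nnegrE // !real_normK ?num_real //.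
    have wu : w * u <= w * (c0 * S * W) by rewrite ler_wpM2l.
    have sq : 0 <= (c0 * w - S * W) ^+ 2 by rewrite sqr_ge0.
    have -> : (2 * D) ^+ 2 = 4 * D ^+ 2 by ring.
    have : (c0 * w + S * W) ^+ 2 = (c0 * w - S * W) ^+ 2 + 4 * (w * (c0 * S * W)) by ring.
    by lra.
  have half1 : 2^-1 <= 1 :> R by lra.
  have h2 : 2 * F <= err.
    have sI : 0 <= s <= t by rewrite s0.
    have [xN yN] := HA N s sI; have [xN1 yN1] := HA N.+1 s sI.
    have P1 : `|X N s * Y N.+1 s| <= A ^+ 2 * 2^-1 ^+ N.
      rewrite normrM; apply: (@le_trans _ _ ((A * 2^-1 ^+ N) * (A * 2^-1 ^+ N.+1))).
        by rewrite ler_pM.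
      rewrite mulrACA -expr2 ler_wpM2l ?sqr_ge0 //.
      by rewrite ler_piMr ?exprn_ge0 // exprn_ile1 // half1.
    have P2 : `|Y N s * X N.+1 s| <= A ^+ 2 * 2^-1 ^+ N.
      rewrite normrM; apply: (@le_trans _ _ ((A * 2^-1 ^+ N) * (A * 2^-1 ^+ N.+1))).
        by rewrite ler_pM.
      rewrite mulrACA -expr2 ler_wpM2l ?sqr_ge0 //.
      by rewrite ler_piMr ?exprn_ge0 // exprn_ile1 // half1.
    move: P1 P2; rewrite /F /err !ler_norml => /andP[_ P1] /andP[P2 _].
    by lra.
  have err0 : 0 <= err by rewrite /err !(sqr_ge0, exprn_ge0, mulr_ge0).
  have cU : c0 * (X a s ^+ 2 + Y a s ^+ 2) <= c0 * energy N.+1 s by rewrite ler_wpM2l.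
  have h3 : - c0 * energy N.+1 s + (2 * D + 2 * F) <= S * W + err by lra.
  have h4 : Z * (- c0 * energy N.+1 s + (2 * D + 2 * F)) <= Z * (S * W + err).
    by rewrite ler_pM2l.
  have h5 : Z * (S * W + err) <= S + err.
    rewrite mulrDr mulrCA ZW mulr1 lerD2l ler_piMl //.
  rewrite (_ : - c0 * Z * _ + _ = Z * (- c0 * energy N.+1 s + (2 * D + 2 * F))); last by ring.
  by lra.
rewrite /phi !mulr0 expR0 mul1r addr0 => H.
have := HE N.+1 => H0.
have : expR (- c0 * t) * energy N.+1 t <= E0 + (S + err) * t by lra.
rewrite mulNr expRN mulrC ler_pdivrMr ?expR_gt0 // => H1.
apply: le_trans H1 _; have -> : (E0 + (S + err) * t) * expR (c0 * t) =
  (E0 + S * t) * expR (c0 * t) + err * t * expR (c0 * t) by ring.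
by rewrite lerD2l.
Qed.

End Waves.
End Chains.

(** * Convolution with the kernel *)

Section Gramian.
Variables (R : realType) (q : nat) (e : 'I_q -> R).

Let a := node_weight e.

(** The kernel is [k u = kernel_cos u - i kernel_sin u]. *)
Definition kernel_cos (u : R) := \sum_j a j * cos (e j * u).
Definition kernel_sin (u : R) := \sum_j a j * sin (e j * u).

(* Primitive of [exp (- h u) * |k u| ^ 2], with [k u = sum_j a_j exp (- i e_j u)]. *)
Definition gram_primitive (h u : R) := \sum_j \sum_l a j * a l *
  ((h ^+ 2 + (e j - e l) ^+ 2)^-1 * (- expR (- h * u) *
    (h * cos ((e j - e l) * u) - (e j - e l) * sin ((e j - e l) * u)))).

Lemma is_derive_cosM (c x : R) : is_derive x 1 (fun t => cos (c * t)) (- c * sin (c * x)).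
Proof.
have L : is_derive x 1 (fun t : R => c * t) (c * 1).
  by apply: is_derive_scale; exact: is_derive_id.
have := @is_derive1_comp R (@cos R) (fun t => c * t) x _ _ (is_derive_cos _) L.
by rewrite mulr1 mulrC mulrN mulNr.
Qed.

Lemma is_derive_sinM (c x : R) : is_derive x 1 (fun t => sin (c * t)) (c * cos (c * x)).
Proof.
have L : is_derive x 1 (fun t : R => c * t) (c * 1).
  by apply: is_derive_scale; exact: is_derive_id.
have := @is_derive1_comp R (@sin R) (fun t => c * t) x _ _ (is_derive_sin _) L.
by rewrite mulr1 mulrC.
Qed.

Lemma is_derive_reflect (f : R -> R) (t s b : R) : is_derive (t - s) 1 f b ->
  is_derive s 1 (fun s => f (t - s)) (- b).
Proof.
move=> fb.
have L : is_derive s 1 (fun s : R => t - s) (0 - 1) by exact: is_deriveB.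
have := @is_derive1_comp R f (fun s => t - s) s _ _ fb L.
by rewrite sub0r mulrN1.
Qed.

Variable h : R.
Hypothesis h0 : 0 < h.

Lemma gram_primitive_derive (u : R) : is_derive u 1 (gram_primitive h)
  (expR (- h * u) * (kernel_cos u ^+ 2 + kernel_sin u ^+ 2)).
Proof.
have -> : expR (- h * u) * (kernel_cos u ^+ 2 + kernel_sin u ^+ 2) =
  \sum_j \sum_l a j * a l * (expR (- h * u) * cos ((e j - e l) * u)).
  transitivity (expR (- h * u) *
     \sum_j \sum_l a j * a l * (cos (e j * u) * cos (e l * u) + sin (e j * u) * sin (e l * u))).
    congr (_ * _); rewrite /kernel_cos /kernel_sin !expr2 !mulr_suml -big_split /=.
    apply: eq_bigr => j _; rewrite !mulr_sumr -big_split /=.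
    by apply: eq_bigr => l _; ring.
  rewrite mulr_sumr; apply: eq_bigr => j _; rewrite mulr_sumr; apply: eq_bigr => l _.
  by rewrite mulrBl cosB; ring.
apply: is_derive_bigsum => j; apply: is_derive_bigsum => l; apply: is_derive_scale.
set d := e j - e l.
have D : h ^+ 2 + d ^+ 2 != 0.
  by rewrite gt_eqF // ltr_wpDr ?sqr_ge0 // exprn_gt0.
have H : is_derive u 1 (fun u => -1 * expR (- h * u) * (h * cos (d * u) + - d * sin (d * u)))
  ((-1 * (- h * expR (- h * u))) * (h * cos (d * u) + - d * sin (d * u)) +
   (-1 * expR (- h * u)) * (h * (- d * sin (d * u)) + - d * (d * cos (d * u)))).
  apply: is_derive_mul; first by apply: is_derive_scale; exact: is_derive_expRM.
  by apply: is_derive_add; apply: is_derive_scale; [exact: is_derive_cosM|exact: is_derive_sinM].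
have -> : (fun x => (h ^+ 2 + d ^+ 2)^-1 * (- expR (- h * x) *
    (h * cos (d * x) - d * sin (d * x)))) =
  (fun x => (h ^+ 2 + d ^+ 2)^-1 * (-1 * expR (- h * x) *
    (h * cos (d * x) + - d * sin (d * x)))) by apply/funext => x; ring.
have -> : expR (- h * u) * cos (d * u) = (h ^+ 2 + d ^+ 2)^-1 *
  ((-1 * (- h * expR (- h * u))) * (h * cos (d * u) + - d * sin (d * u)) +
   (-1 * expR (- h * u)) * (h * (- d * sin (d * u)) + - d * (d * cos (d * u)))).
  by field.
exact: is_derive_scale H.
Qed.

Lemma gram_primitive0 : gram_primitive h 0 = - node_gram e h.
Proof.
rewrite /gram_primitive /node_gram -sumrN; apply: eq_bigr => j _.
rewrite -sumrN; apply: eq_bigr => l _.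
by rewrite /a !mulr0 cos0 sin0 expR0; ring.
Qed.

(** The primitive is nondecreasing and tends to 0 at infinity. With its value at 0, this bounds the
    weighted integral of [|k| ^ 2] over any [[0, u]] by [node_gram]. *)
Lemma gram_primitive_le0 (u : R) : 0 <= u -> gram_primitive h u <= 0.
Proof.
move=> u0; rewrite leNgt; apply/negP => J0; set J := gram_primitive h u in J0.
pose Q := \sum_j \sum_l `|a j * a l| * ((h ^+ 2 + (e j - e l) ^+ 2)^-1 * (h + `|e j - e l|)).
have Q0 : 0 <= Q.
  apply: sumr_ge0 => j _; apply: sumr_ge0 => l _.
  by rewrite !mulr_ge0 ?invr_ge0 ?addr_ge0 ?sqr_ge0 ?(ltW h0).
have JQ x : gram_primitive h x <= Q * expR (- h * x).
  rewrite /gram_primitive /Q mulr_suml; apply: ler_sum => j _.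
  rewrite mulr_suml; apply: ler_sum => l _; set d := e j - e l.
  apply: le_trans (ler_norm _) _; rewrite !normrM normrN -!mulrA.
  rewrite ler_wpM2l // ler_wpM2l // ger0_norm ?invr_ge0 ?addr_ge0 ?sqr_ge0 //.
  rewrite ler_wpM2l ?invr_ge0 ?addr_ge0 ?sqr_ge0 // [leRHS]mulrC.
  rewrite (ger0_norm (expR_ge0 _)) ler_wpM2l ?expR_ge0 //.
  apply: le_trans (ler_normB _ _) _; rewrite !normrM (gtr0_norm h0) lerD //.
    by rewrite ler_piMr ?(ltW h0) // cos_max.
  by rewrite ler_piMr // sin_max.
(* Far enough to the right that [J (1 + h x)] exceeds [Q], so the exponential bound falls below
   [J]. *)
pose x := u + Q / (h * J).
have hJ : 0 < h * J by rewrite mulr_gt0.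
have ux : u <= x by rewrite /x lerDl divr_ge0 // ltW.
have Jx : J <= gram_primitive h x.
  rewrite -[J]opprK -[leRHS]opprK lerN2.
  apply: (@le0_derive_nincr _ (fun y => - gram_primitive h y)
     (fun y => - (expR (- h * y) * (kernel_cos y ^+ 2 + kernel_sin y ^+ 2)))) => //.
    by move=> y; apply: is_deriveN; exact: gram_primitive_derive.
  by move=> y _; rewrite oppr_le0 mulr_ge0 ?expR_ge0 ?addr_ge0 ?sqr_ge0.
have := le_trans Jx (JQ x).
rewrite mulNr expRN ler_pdivlMr ?expR_gt0 // leNgt => /negP; apply.
apply: lt_le_trans (_ : J * (1 + h * x) <= _); last first.
  by rewrite ler_pM2l // expR_ge1Dx.
have -> : J * (1 + h * x) = J + J * h * u + Q.
  by rewrite /x; field; rewrite !gt_eqF.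
have : 0 <= J * h * u by rewrite !mulr_ge0 ?(ltW h0) ?(ltW J0).
by lra.
Qed.

End Gramian.

Section Convolution.
Variables (R : realType) (q : nat) (e : 'I_q -> R).
Variables (psi w : nat -> R) (d : 'I_q -> nat -> R).
Hypotheses (d_exp : forall j, exp_type (d j)) (w_exp : exp_type w)
  (d_rec : forall j k, d j k.+1 = e j * d j k + w k)
  (d0 : forall j, d j 0%N = 0)
  (psiE : forall k, psi k = \sum_j node_weight e j * d j k).

Let a := node_weight e.

Lemma psi_wave (t : R) : wave_re psi t = \sum_j a j * wave_re (d j) t /\
  wave_im psi t = \sum_j a j * wave_im (d j) t.
Proof.
have -> : psi = fun k => \sum_j a j * d j k by apply/funext => k; exact: psiE.
have [H1 H2] : exp_type (fun k => \sum_j a j * d j k) /\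
  (wave_re (fun k => \sum_j a j * d j k) t = \sum_j a j * wave_re (d j) t /\
  wave_im (fun k => \sum_j a j * d j k) t = \sum_j a j * wave_im (d j) t); last by [].
elim: (index_enum _) => [|j r [IH1 [IH2 IH3]]].
  have E : (fun k : nat => \sum_(j <- [::]) a j * d j k) = fun=> 0.
    by apply/funext => k; rewrite big_nil.
  by rewrite E !big_nil wave_re_zero wave_im_zero; split=> //; exact: exp_type0.
have E : (fun k : nat => \sum_(j <- j :: r) a j * d j k) =
    fun k => a j * d j k + \sum_(j <- r) a j * d j k.
  by apply/funext => k; rewrite big_cons.
rewrite E !big_cons wave_re_lin // wave_im_lin // IH2 IH3; split=> //.
by apply: exp_type_add => //; exact: exp_type_scale.
Qed.

Lemma d_wave_derive j (s : R) :
  is_derive s 1 (wave_re (d j)) (e j * wave_im (d j) s + wave_im w s) /\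
  is_derive s 1 (wave_im (d j)) (- (e j * wave_re (d j) s + wave_re w s)).
Proof.
have E : (fun k => d j k.+1) = fun k => e j * d j k + w k by apply/funext => k.
split; apply: is_derive_eq.
- by apply: wave_re_derive.
- by rewrite E wave_im_lin.
- by apply: wave_im_derive.
- by rewrite E wave_re_lin.
Qed.

(** Each [d j] solves [i d' = e_j d + w] from 0, so [psi] at [t] is [- i] times the integral of
    [k (t - s) w s]. Cauchy-Schwarz with weights [exp (- h (t - s))] and [exp (h (t - s))], where
    [h = 2 eta], gives the factors [kap] and [W0 exp (h t) / eta]. The proof replaces the integrals
    by a monotone function. *)
Lemma convolution_bound (eta W0 kap t : R) : 0 < eta -> 0 < kap -> 0 <= t ->
  node_gram e (2 * eta) <= kap ->
  (forall s, 0 <= s -> wave_re w s ^+ 2 + wave_im w s ^+ 2 <= W0 * expR (eta * s)) ->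
  wave_re psi t ^+ 2 + wave_im psi t ^+ 2 <= kap * W0 / eta * expR (2 * eta * t).
Proof.
move=> eta0 kap0 t0 Hk Hw; set h := 2 * eta.
have h0 : 0 < h by rewrite mulr_gt0.
set zr := wave_re psi t; set zi := wave_im psi t.
set N := zr ^+ 2 + zi ^+ 2.
have N0 : 0 <= N by rewrite addr_ge0 ?sqr_ge0.
pose vr j s := wave_re (d j) s; pose vi j s := wave_im (d j) s.
pose C j s := cos (e j * (t - s)); pose S j s := sin (e j * (t - s)).
(* With [z = zr + i zi], this is the real part of [conj z] times the sum of
   [a_j exp (- i e_j (t - s)) d_j s]. It is 0 at [s = 0] and [N] at [s = t]. *)
pose P s := \sum_j a j * ((zr * C j s + - zi * S j s) * vr j s
                          + (zr * S j s + zi * C j s) * vi j s).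
(* [P] minus, up to constants, primitives of the two terms bounding [P'] by the inequality of
   arithmetic and geometric means, with weights [1 / (2 kap)] and [kap / 2]; hence [Rs] is
   nonincreasing. *)
pose Rs (s : R) := P s + (2 * kap)^-1 * N * gram_primitive e h (t - s)
  + kap / 2 * W0 * expR (h * t) / eta * expR (- eta * s).
pose kc s := kernel_cos e (t - s); pose ks s := kernel_sin e (t - s).
have dC j (s : R) : is_derive s 1 (C j) (e j * S j s).
  have := is_derive_reflect (is_derive_cosM (e j) (t - s)).
  by rewrite mulNr opprK.
have dS j (s : R) : is_derive s 1 (S j) (- (e j * C j s)).
  exact: is_derive_reflect (is_derive_sinM (e j) (t - s)).
have dP (s : R) : is_derive s 1 P (zr * (kc s * wave_im w s - ks s * wave_re w s)
   - zi * (ks s * wave_im w s + kc s * wave_re w s)).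
  have -> : zr * (kc s * wave_im w s - ks s * wave_re w s)
   - zi * (ks s * wave_im w s + kc s * wave_re w s) =
    \sum_j a j * (((zr * (e j * S j s) + - zi * - (e j * C j s)) * vr j s
        + (zr * C j s + - zi * S j s) * (e j * vi j s + wave_im w s))
      + ((zr * - (e j * C j s) + zi * (e j * S j s)) * vi j s
        + (zr * S j s + zi * C j s) * - (e j * vr j s + wave_re w s))).
    rewrite /kc /ks /kernel_cos /kernel_sin !mulr_suml -sumrB -big_split /= !mulr_sumr -sumrB.
    by apply: eq_bigr => j _; rewrite -/(C j s) -/(S j s) /a; ring.
  apply: is_derive_bigsum => j; apply: is_derive_scale.
  have [dr di] := d_wave_derive j s.
  have dCj := dC j s; have dSj := dS j s.
  apply: is_derive_add.
    exact: (is_derive_mul (is_derive_add (is_derive_scale zr dCj) (is_derive_scale (- zi) dSj)) dr).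
  exact: (is_derive_mul (is_derive_add (is_derive_scale zr dSj) (is_derive_scale zi dCj)) di).
have dR (s : R) : is_derive s 1 Rs (zr * (kc s * wave_im w s - ks s * wave_re w s)
   - zi * (ks s * wave_im w s + kc s * wave_re w s)
   + (2 * kap)^-1 * N * - (expR (- h * (t - s)) * (kc s ^+ 2 + ks s ^+ 2))
   + kap / 2 * W0 * expR (h * t) / eta * (- eta * expR (- eta * s))).
  have dG := is_derive_reflect (gram_primitive_derive e h0 (t - s)).
  exact: (is_derive_add (is_derive_add (dP s) (is_derive_scale _ dG))
    (is_derive_scale _ (is_derive_expRM (- eta) s))).
have mono : Rs t <= Rs 0.
  apply: (le0_derive_nincr t0 dR) => s /andP[s0 st].
  set wr := wave_re w s; set wi := wave_im w s.
  have wb := Hw s s0; rewrite -/wr -/wi in wb.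
  set X := expR (- h * (t - s)); have X0 : 0 < X by exact: expR_gt0.
  have e1 : expR (h * t) / eta * (- eta * expR (- eta * s)) =
     - (expR (eta * s) / X).
    have -> : X = expR (eta * s) ^+ 2 / expR (h * t).
      have -> : X = expR (eta * s + eta * s - h * t) by congr expR; rewrite /h; ring.
      by rewrite !expRD expRN expr2.
    have -> : expR (- eta * s) = (expR (eta * s))^-1 by rewrite mulNr expRN.
    by field; rewrite !gt_eqF ?expR_gt0.
  rewrite -[X in _ + X](_ : kap / 2 * (W0 * - (expR (eta * s) / X)) = _); last first.
    by rewrite -e1; ring.
  set k2 := kc s ^+ 2 + ks s ^+ 2.
  set D := zr * _ - zi * _.
  have cs : D ^+ 2 <= N * k2 * (wr ^+ 2 + wi ^+ 2).
    rewrite -subr_ge0 (_ : _ - _ =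
      (zr * (kc s * wr + ks s * wi) + zi * (kc s * wi - ks s * wr)) ^+ 2) ?sqr_ge0 //.
    by rewrite /N /k2 /D -/wr -/wi; ring.
  set u := (2 * kap)^-1 * N * (X * k2).
  set v := kap / 2 * ((wr ^+ 2 + wi ^+ 2) / X).
  have k20 : 0 <= k2 by rewrite addr_ge0 ?sqr_ge0.
  have w20 : 0 <= wr ^+ 2 + wi ^+ 2 by rewrite addr_ge0 ?sqr_ge0.
  have u0 : 0 <= u by rewrite !mulr_ge0 ?invr_ge0 ?(ltW X0) // mulr_ge0 // ltW.
  have v0 : 0 <= v by rewrite !mulr_ge0 ?invr_ge0 ?(ltW X0) ?(ltW kap0).
  have uv : N * k2 * (wr ^+ 2 + wi ^+ 2) = 4 * (u * v).
    by rewrite /u /v; field; rewrite !gt_eqF.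
  have Duv : D <= u + v.
    apply: le_trans (ler_norm _) _.
    rewrite -[leRHS]ger0_norm ?addr_ge0 // -ler_sqr ?nnegrE // !real_normK ?num_real //.
    have := sqr_ge0 (u - v).
    have -> : (u + v) ^+ 2 = (u - v) ^+ 2 + 4 * (u * v) by ring.
    by lra.
  have vW : v <= kap / 2 * (W0 * (expR (eta * s) / X)).
    rewrite /v ler_wpM2l ?divr_ge0 ?(ltW kap0) // mulrA.
    by rewrite ler_wpM2r ?invr_ge0 ?(ltW X0).
  rewrite !mulrN -/u.
  by lra.
(* At [s = t] the kernel term costs at most half of [N], because [node_gram] is at most [kap]. *)
have Rt : N - N / 2 <= Rs t.
  have [pr pi] := psi_wave t.
  rewrite /Rs subrr gram_primitive0.
  have -> : P t = N.
    rewrite /P /C /S subrr.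
    transitivity (zr * (\sum_j a j * wave_re (d j) t) + zi * (\sum_j a j * wave_im (d j) t)).
      rewrite !mulr_sumr -big_split /=.
      by apply: eq_bigr => j _; rewrite mulr0 cos0 sin0 /vr /vi; ring.
    by rewrite -pr -pi /N !expr2.
  have h1 : N / 2 >= (2 * kap)^-1 * N * node_gram e h.
    rewrite -[leRHS](_ : (2 * kap)^-1 * N * kap = _); last by field; rewrite gt_eqF.
    by rewrite ler_wpM2l // mulr_ge0 // invr_ge0 mulr_ge0 // ltW.
  have W00 : 0 <= W0.
    have := Hw 0 (lexx _); rewrite mulr0 expR0 mulr1; apply: le_trans.
    by rewrite addr_ge0 ?sqr_ge0.
  have : 0 <= kap / 2 * W0 * expR (h * t) / eta * expR (- eta * t).
    by rewrite !mulr_ge0 ?expR_ge0 ?invr_ge0 // ltW.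
  by rewrite mulrN; lra.
have R0 : Rs 0 <= kap / 2 * W0 * expR (h * t) / eta.
  rewrite /Rs mulr0 expR0 mulr1 subr0.
  have -> : P 0 = 0.
    rewrite /P big1 // => j _; rewrite /vr /vi wave_re0 wave_im0 d0; ring.
  rewrite add0r gerDr; apply: mulr_ge0_le0; last exact: gram_primitive_le0.
  by rewrite mulr_ge0 // invr_ge0 mulr_ge0 // ltW.
have -> : kap * W0 / eta * expR (h * t) = 2 * (kap / 2 * W0 * expR (h * t) / eta).
  by field; rewrite gt_eqF.
by lra.
Qed.

End Convolution.

(** * Transport past the first period *)

Section Pairing.
Variables (R : realType) (c : nat -> R).
Implicit Types (p g : {poly R}).

(** The linear functional sending ['X^k] to [c k]. When [c k] is coordinate [n] of [H ^ k delta_0],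
    its value at [p] is coordinate [n] of [p(H) delta_0], and multiplying [p] by ['X] amounts to
    applying [i d/dt] to the wave. *)
Definition pairing p : R := \sum_(i < size p) p`_i * c i.

Lemma pairingE n p : (size p <= n)%N -> pairing p = \sum_(i < n) p`_i * c i.
Proof.
move=> pn; rewrite /pairing (big_ord_widen n (fun i => p`_i * c i) pn) big_mkcond /=.
apply: eq_bigr => i _; case: ltnP => // pi; by rewrite nth_default // mul0r.
Qed.

Lemma pairingD p g : pairing (p + g) = pairing p + pairing g.
Proof.
pose n := maxn (size p) (size g).
rewrite (@pairingE n p) ?leq_maxl // (@pairingE n g) ?leq_maxr //.
rewrite (@pairingE n (p + g)); last exact: size_polyD.
by rewrite -big_split; apply: eq_bigr => i _; rewrite coefD mulrDl.
Qed.

Lemma pairingZ x p : pairing (x *: p) = x * pairing p.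
Proof.
rewrite (@pairingE (size p)) ?size_scale_leq // mulr_sumr.
by apply: eq_bigr => i _; rewrite coefZ mulrA.
Qed.

Lemma pairingB p g : pairing (p - g) = pairing p - pairing g.
Proof. by rewrite -scaleN1r pairingD pairingZ mulN1r. Qed.

Lemma pairingXn k : pairing 'X^k = c k.
Proof.
rewrite (@pairingE k.+1) ?size_polyXn // big_ord_recr /= coefXn eqxx mul1r.
rewrite big1 ?add0r // => i _; rewrite coefXn (_ : (nat_of_ord i == k) = false) ?mul0r //.
by apply/negbTE; rewrite neq_ltn ltn_ord.
Qed.

Lemma pairing0 : pairing 0 = 0.
Proof. by rewrite /pairing size_poly0 big_ord0. Qed.

Lemma pairing_sum (I : Type) (r : seq I) (F : I -> {poly R}) :
  pairing (\sum_(i <- r) F i) = \sum_(i <- r) pairing (F i).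
Proof. exact: (big_morph _ pairingD pairing0). Qed.

Lemma pairing_mulX p (x : R) k : pairing (('X - x%:P) * p * 'X^k) =
  pairing (p * 'X^(k.+1)) - x * pairing (p * 'X^k).
Proof.
rewrite -pairingZ -pairingB; congr pairing.
by rewrite exprS -mul_polyC; ring.
Qed.

Lemma pairing_exp_type p : exp_type c -> exp_type (fun k => pairing (p * 'X^k)).
Proof.
move=> Hc; elim/poly_ind: p => [|p x IH].
  exists 0, 0 => k; by rewrite mul0r pairing0 normr0 mul0r.
have -> : (fun k => pairing ((p * 'X + x%:P) * 'X^k)) =
    (fun k => pairing (p * 'X^(k.+1)) + x * c k).
  apply/funext => k; rewrite -pairingXn -pairingZ -pairingD; congr pairing.
  by rewrite mulrDl exprS mulrA mul_polyC.
by apply: exp_type_add; [exact: (exp_type_shift IH)|exact: exp_type_scale].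
Qed.

End Pairing.

Section ChainPairing.
Variables (R : realType) (V : nat -> R).

Definition prev (u : nat -> R) (n : nat) : R := if n is m.+1 then u m else 0.

(** The coefficients of the wave with zero initial data driven by [g] at site [a]. *)
Fixpoint forced (W : nat -> R) (a : nat) (g : nat -> R) (k : nat) : nat -> R :=
  if k is l.+1 then fun n => jacobi_op W (forced W a g l) n + g l * site R a n
  else fun=> 0.

Lemma jacobi_op_site (W : nat -> R) m n : jacobi_op W (site R m) n =
  site R m.+1 n + prev (fun l => site R l n) m + W m * site R m n.
Proof.
rewrite /jacobi_op /site /prev.
have -> : W n * (n == m)%:R = W m * (n == m)%:R by case: eqP => [->|]; rewrite ?mulr0.
congr (_ + _); case: n => [|n]; case: m => [|m]; rewrite ?eqSS ?addr0 ?add0r //.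
by rewrite addrC.
Qed.

(** [H] commutes with its powers, so the extra factor may be applied to [delta_m] first. *)
Lemma chainS W m k n : chain W m k.+1 n =
  chain W m.+1 k n + prev (fun l => chain W l k n) m + W m * chain W m k n :> R.
Proof.
elim: k n => [|k IH] n; first exact: jacobi_op_site.
rewrite -[LHS]/(jacobi_op W (chain W m k.+1) n).
have E u : chain W u k.+1 n = jacobi_op W (chain W u k) n by [].
have Hp : jacobi_op W (chain W m k.+1) n = jacobi_op W
    (fun n => chain W m.+1 k n + prev (fun l => chain W l k n) m + W m * chain W m k n) n.
  by rewrite /jacobi_op; case: (n) => [|l]; rewrite !IH.
rewrite Hp E /prev /jacobi_op; case: (m) => [|m']; rewrite ?E /jacobi_op; case: (n) => [|l]; ring.
Qed.

(** The response is linear in the source vector and commutes with [H]: the response to [H delta_a]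
    replaces [H] applied to the response to [delta_a]. *)
Lemma forced_shift W a g k n : forced W a g k.+1 n =
  g k * site R a n + forced W a.+1 g k n + prev (fun b => forced W b g k n) a
  + W a * forced W a g k n.
Proof.
elim: k n => [|k IH] n.
  by rewrite /= /jacobi_op /prev; case: n => [|n]; case: a => [|a]; ring.
rewrite -[LHS]/(jacobi_op W (forced W a g k.+1) n + g k.+1 * site R a n).
have E b : forced W b g k.+1 n = jacobi_op W (forced W b g k) n + g k * site R b n by [].
have Hp : jacobi_op W (forced W a g k.+1) n = jacobi_op W (fun n => g k * site R a n
    + forced W a.+1 g k n + prev (fun b => forced W b g k n) a + W a * forced W a g k n) n.
  by rewrite /jacobi_op; case: (n) => [|l]; rewrite !IH.
have J : jacobi_op W (forced W a g k.+1) n = g k * jacobi_op W (site R a) n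
   + jacobi_op W (forced W a.+1 g k) n + prev (fun b => jacobi_op W (forced W b g k) n) a
   + W a * jacobi_op W (forced W a g k) n.
  by rewrite Hp /jacobi_op /prev; case: (a) => [|b]; case: (n) => [|l]; ring.
rewrite J jacobi_op_site !E /prev; case: (a) => [|b]; rewrite ?E; ring.
Qed.

(** The polynomials satisfy the recurrence by which [H] moves from site to site, whence
    [p_m(H) delta_0 = delta_m]. *)
Lemma pairing_jacobi_poly m k n :
  pairing (fun k => chain V 0 k n) (jacobi_poly V m * 'X^k) = chain V m k n.
Proof.
have [] // : (forall k, pairing (fun k => chain V 0 k n) (jacobi_poly V m * 'X^k) = chain V m k n)
  /\ (forall k, pairing (fun k => chain V 0 k n) (jacobi_poly V m.+1 * 'X^k) = chain V m.+1 k n).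
elim: m {k} => [|m [IH1 IH2]]; split => // k.
- by rewrite /jacobi_poly mul1r pairingXn.
- rewrite /jacobi_poly {1}/continuant mulr1 subr0 -[_ - _]mulr1 pairing_mulX !mul1r !pairingXn.
  by rewrite chainS /prev addr0 addrK.
- rewrite /jacobi_poly continuantSS mulrBl pairingB pairing_mulX IH1 !IH2.
  by rewrite chainS /prev; ring.
Qed.

Let V' : nat -> R := fun n => V n.+1.
Let g k := chain V 0 k 0.

(** Removing site 0 leaves the half line started one site later, driven at its first site by the
    amplitude [g] at site 0. *)
Lemma chain_forced k n : chain V 0 k n.+1 = forced V' 0 g k n.
Proof.
elim: k n => [|k IH] n; first by [].
rewrite -[LHS]/(jacobi_op V (chain V 0 k) n.+1).
by case: n => [|n]; rewrite /= /jacobi_op !IH /V' /site /g /=; ring.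
Qed.

(** The same induction with [forced_shift]; the additional source terms sit at sites strictly before
    [n], which is where [m <= n] enters. *)
Lemma pairing_jacobi_poly2 m k n : (m <= n)%N ->
  pairing (fun k => chain V 0 k n.+1) (jacobi_poly2 V m.+1 * 'X^k) = forced V' m g k n.
Proof.
set L := pairing _.
have J0 k' : L (jacobi_poly2 V 1 * 'X^k') = forced V' 0 g k' n.
  by rewrite /jacobi_poly2 mul1r /L pairingXn chain_forced.
suff H : ((m <= n)%N -> forall k, L (jacobi_poly2 V m.+1 * 'X^k) = forced V' m g k n)
  /\ ((m.+1 <= n)%N -> forall k, L (jacobi_poly2 V m.+2 * 'X^k) = forced V' m.+1 g k n).
  by move=> mn; exact: H.1.
elim: m {k} => [|m [IH1 IH2]]; split => //.
- move=> n0 k; rewrite /jacobi_poly2 continuant2SS subr0 /L pairing_mulX -/L.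
  rewrite -!/(jacobi_poly2 V 1) !J0 forced_shift /prev /V' /site.
  rewrite (_ : (n == 0%N) = false) ?gtn_eqF // mulr0n; ring.
- move=> mn k; rewrite /jacobi_poly2 continuant2SS mulrBl /L pairingB pairing_mulX -/L.
  rewrite -!/(jacobi_poly2 V _) !IH2 1?ltnW // IH1; last by lia.
  by rewrite forced_shift /prev /V' /site (_ : (n == m.+1) = false) ?gtn_eqF // mulr0n; ring.
Qed.

(** At site [q] the discriminant turns the wave into a freely evolving chain started at [q], minus a
    forced wave; both can be bounded independently of [q]. *)
Lemma pairing_discriminant r k :
  pairing (fun k => chain V 0 k r.+3) (discriminant V r.+3 * 'X^k) =
  chain V r.+3 k r.+3 - forced V' r.+1 g k r.+2.
Proof.
by rewrite mulrBl pairingB pairing_jacobi_poly pairing_jacobi_poly2.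
Qed.

Lemma chain_light_cone k n : (k < n)%N -> chain V 0 k n = 0.
Proof.
elim: k n => [|k IH] n kn; first by rewrite /chain /= /site gtn_eqF.
rewrite -[LHS]/(jacobi_op V (chain V 0 k) n) /jacobi_op.
case: n kn => [|n] // kn; rewrite !IH; [by ring|lia..].
Qed.

Lemma pairing_light_cone (p : {poly R}) n :
  (size p <= n)%N -> pairing (fun k => chain V 0 k n) p = 0.
Proof.
move=> pn; rewrite (pairingE _ pn) big1 // => i _.
by rewrite chain_light_cone ?mulr0.
Qed.


Lemma forced_solution W a (f : nat -> R) : solution_family W a f (forced W a f).
Proof. by []. Qed.

Variable v : R.
Hypothesis Vv : forall n, `|V n| <= v.

Lemma chain_exp_type W m n : (forall n, `|W n| <= v) -> exp_type (fun k => chain W m k n : R).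
Proof. by move=> Wv; apply: decaying_family_exp_type; exact: chain_decay Wv. Qed.

Lemma energy_term c N n (t : R) : (n < N)%N ->
  wave_re (fun k => c k n) t ^+ 2 + wave_im (fun k => c k n) t ^+ 2 <= energy c N t.
Proof.
move=> nN; rewrite /energy (bigD1 (Ordinal nN)) //= lerDl.
by apply: sumr_ge0 => i _; rewrite addr_ge0 ?sqr_ge0.
Qed.

(** Unitarity: the energy bound with no source and initial energy at most 1. *)
Lemma chain_contraction m n (t : R) : 0 <= t ->
  wave_re (fun k => chain V m k n) t ^+ 2 + wave_im (fun k => chain V m k n) t ^+ 2 <= 1.
Proof.
move=> t0; apply: le_trans (@energy_term _ n.+1 n t _) _ => //.
have := @energy_bound R V 0 (fun=> 0) (chain V m) (chain_decay m Vv) (exp_type0 R)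
  (chain_solution V m) 0 0 1.
move=> H; apply: le_trans (H (lexx _) (lexx _) _ _ n.+1 t t0) _; first last.
- by rewrite !mul0r addr0 expR0 mulr1.
- move=> N; rewrite /energy.
  under eq_bigr do rewrite wave_re0 wave_im0 expr0n addr0 -[chain V m 0 _]/(site R m _).
  have [mN|Nm] := ltnP m N.
    have sm : site R m m = 1 by rewrite /site eqxx.
    rewrite (bigD1 (Ordinal mN)) //= sm expr1n big1 ?addr0 // => i im.
    by rewrite /site (_ : (nat_of_ord i == m) = false) ?expr0n //; apply/negbTE.
  rewrite big1 // => i _; rewrite /site (_ : (nat_of_ord i == m) = false) ?expr0n //.
  by rewrite ltn_eqF // (leq_trans (ltn_ord i)).
- by move=> s _; rewrite wave_re_zero wave_im_zero expr0n addr0 !mul0r.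
Qed.

(** The energy bound with [c0 = eta / 2] and [S = 2 / eta], as [|g| <= 1]; the linear factor in [t]
    is absorbed by half of the exponential. *)
Lemma forced_bound m n (eta t : R) : 0 < eta -> 0 <= t ->
  wave_re (fun k => forced V' m g k n) t ^+ 2 + wave_im (fun k => forced V' m g k n) t ^+ 2
  <= 4 / eta ^+ 2 * expR (eta * t).
Proof.
move=> eta0 t0; apply: le_trans (@energy_term _ n.+1 n t _) _ => //.
have gexp : exp_type g by exact: chain_exp_type.
have fdec : decaying_family (forced V' m g).
  apply: (@solution_family_decay R V' m g _ v) => //;
    last by exists 0 => k; rewrite /= normr0 mul0r.
  by move=> k; exact: Vv.
have c0 : 0 < eta / 2 by rewrite divr_gt0.
have S0 : 0 <= (eta / 2)^-1 by rewrite invr_ge0 ltW.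
have H := energy_bound fdec gexp (@forced_solution V' m g) (ltW c0) S0 (E0 := 0).
apply: le_trans (H _ _ n.+1 t t0) _.
- move=> s s0; rewrite mulfV ?gt_eqF // mul1r.
  apply: le_trans (chain_contraction 0 0 s0) _.
  by apply: le_trans (expR_ge1Dx _); rewrite lerDl mulr_ge0 // ltW.
- by move=> N; rewrite /energy big1 // => i _; rewrite wave_re0 wave_im0 !expr0n addr0.
rewrite add0r; have -> : expR (eta * t) = expR (eta / 2 * t) * expR (eta / 2 * t).
  by rewrite -expRD; congr expR; field.
have tE : eta / 2 * t <= expR (eta / 2 * t).
  by apply: le_trans (expR_ge1Dx _); rewrite lerDr.
have -> : (eta / 2)^-1 * t = 4 / eta ^+ 2 * (eta / 2 * t) by field; rewrite gt_eqF.
rewrite -!mulrA ler_wpM2l // ler_wpM2l ?invr_ge0 ?sqr_ge0 // !mulrA.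
by rewrite ler_wpM2r ?expR_ge0.
Qed.

Lemma discriminant_wave_bound r (eta t : R) : 0 < eta -> 0 <= t ->
  let w k := pairing (fun k => chain V 0 k r.+3) (discriminant V r.+3 * 'X^k) in
  wave_re w t ^+ 2 + wave_im w t ^+ 2 <= (2 + 8 / eta ^+ 2) * expR (eta * t).
Proof.
move=> eta0 t0 /=; set w := fun k => pairing _ _.
have fexp : exp_type (fun k => forced V' r.+1 g k r.+2).
  apply: decaying_family_exp_type.
  apply: (@solution_family_decay R V' r.+1 g _ v) => //.
  - by move=> k; exact: Vv.
  - exact: chain_exp_type.
  - by exists 0 => k; rewrite /= normr0 mul0r.
have cexp : exp_type (fun k => chain V r.+3 k r.+3 : R) by exact: chain_exp_type.
have -> : w = fun k => -1 * forced V' r.+1 g k r.+2 + chain V r.+3 k r.+3.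
  by apply/funext => k; rewrite /w pairing_discriminant mulN1r addrC.
rewrite wave_re_lin // wave_im_lin //.
have h1 := chain_contraction r.+3 r.+3 t0.
have h2 := forced_bound r.+1 r.+2 eta0 t0.
move: h1 h2; set x := wave_re _ _; set y := wave_im _ _.
set x' := wave_re _ _; set y' := wave_im _ _.
move=> h1 h2.
have E1 : 1 <= expR (eta * t) by rewrite -expR0 ler_expR mulr_ge0 // ltW.
have s1 := sqr_ge0 (x + x'); have s2 := sqr_ge0 (y + y').
have i1 : (-1 * x' + x) ^+ 2 + (x + x') ^+ 2 = 2 * x ^+ 2 + 2 * x' ^+ 2 by ring.
have i2 : (-1 * y' + y) ^+ 2 + (y + y') ^+ 2 = 2 * y ^+ 2 + 2 * y' ^+ 2 by ring.
have i3 : (2 + 8 / eta ^+ 2) * expR (eta * t) =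
  2 * expR (eta * t) + 2 * (4 / eta ^+ 2 * expR (eta * t)) by ring.
rewrite i3; lra.
Qed.

Section Transport.
Variables (r : nat) (e : 'I_r.+3 -> R) (T kap : R).
Hypotheses (e_inj : injective e) (eE : discriminant V r.+3 = node_poly e)
  (T0 : 0 < T) (kap0 : 0 < kap) (gram : node_gram e T^-1 <= kap).

Let A := kap * (4 * T * (1 + 16 * T ^+ 2)).

(** The convolution bound with [eta = 1 / (2 T)]. The components [d j] come from the cofactors of
    [D]: multiplying by ['X - e j] gives [D], the initial values vanish since the cofactors have
    degree below [q], and the Lagrange identity recombines them into the amplitude. *)
Lemma boundary_wave_bound (t : R) : 0 <= t ->
  wave_re (fun k => chain V 0 k r.+3) t ^+ 2 + wave_im (fun k => chain V 0 k r.+3) t ^+ 2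
  <= A * expR (T^-1 * t).
Proof.
move=> t0; pose c k := chain V 0 k r.+3 : R.
have cexp : exp_type c by exact: chain_exp_type.
pose d j k := pairing c (node_cofactor e j * 'X^k).
pose w k := pairing c (discriminant V r.+3 * 'X^k).
have eta0 : 0 < (2 * T)^-1 by rewrite invr_gt0 mulr_gt0.
have := @convolution_bound R r.+3 e c w d _ _ _ _ _ (2 * T)^-1 (2 + 8 / (2 * T)^-1 ^+ 2) kap t
  eta0 kap0 t0.
have -> : 2 * (2 * T)^-1 = T^-1 by field; rewrite gt_eqF.
have -> : kap * (2 + 8 / (2 * T)^-1 ^+ 2) / (2 * T)^-1 = A.
  by rewrite /A; field; rewrite gt_eqF.
apply.
- by move=> j; exact: pairing_exp_type.
- exact: pairing_exp_type.
- move=> j k; rewrite /w eE (node_polyE e j) pairing_mulX /d.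
  by ring.
- by move=> j; rewrite /d expr0 mulr1 pairing_light_cone // size_node_cofactor.
- move=> k; rewrite /d -(pairingXn c k).
  have {1}-> : 'X^k = \sum_j node_weight e j *: (node_cofactor e j * 'X^k).
    under eq_bigr do rewrite scalerAl.
    by rewrite -mulr_suml lagrange_one // mul1r.
  by rewrite pairing_sum; apply: eq_bigr => j _; rewrite pairingZ.
- exact: gram.
- by move=> s s0; exact: discriminant_wave_bound.
Qed.

(** The sites from index [r.+4] on form a half line, initially at rest, driven by the amplitude at
    index [r.+3]. The energy bound with [c0 = 1 / T] and [S = A T] produces a factor [T t], absorbed
    by [exp (t / (2 T))]. *)
Lemma tail_wave_bound N (t : R) : 0 <= t ->
  \sum_(n < N) (wave_re (fun k => chain V 0 k (r.+3 + n)) t ^+ 2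
                + wave_im (fun k => chain V 0 k (r.+3 + n)) t ^+ 2)
  <= A * (1 + 2 * T ^+ 2) * expR (3 / 2 * T^-1 * t).
Proof.
move=> t0.
have A0 : 0 <= A.
  by rewrite /A !mulr_ge0 ?(ltW kap0) ?(ltW T0) // addr_ge0 // mulr_ge0 // sqr_ge0.
pose c k n := chain V 0 k (r.+4 + n) : R.
pose f k := chain V 0 k r.+3 : R.
pose W n := V (r.+4 + n)%N.
have Ti : 0 < T^-1 by rewrite invr_gt0.
have sol : solution_family W 0 f c.
  move=> k n; rewrite /c -[LHS]/(jacobi_op V (chain V 0 k) (r.+4 + n)) /jacobi_op /W /f /site.
  by case: n => [|n]; rewrite ?addnS ?addn0 /= ?eqxx; ring.
have cdec : decaying_family c.
  have [B [M [B0 M0 H]]] := chain_decay 0 Vv.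
  exists B, M; split=> // k n; apply: le_trans (H k _) _.
  rewrite ler_wpM2l ?mulr_ge0 ?exprn_ge0 // exprD ler_piMl ?exprn_ge0 //.
  by rewrite exprn_ile1 //; lra.
have fexp : exp_type f by exact: chain_exp_type.
have S0 : 0 <= A * T by rewrite mulr_ge0 // ltW.
have EN M : energy c M t <= A * T * t * expR (T^-1 * t).
  have H := energy_bound cdec fexp sol (ltW Ti) S0 (E0 := 0).
  apply: le_trans (H _ _ M t t0) _; last by rewrite add0r.
    move=> s s0; have -> : T^-1 * (A * T) = A by field; rewrite gt_eqF.
    exact: boundary_wave_bound.
  move=> {}M; rewrite /energy big1 // => i _.
  by rewrite wave_re0 wave_im0 /c chain_light_cone // !expr0n addr0.
have EE : expR (3 / 2 * T^-1 * t) = expR (T^-1 * t) * expR ((2 * T)^-1 * t).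
  by rewrite -expRD; congr expR; field; rewrite gt_eqF.
have E1 : 1 + (2 * T)^-1 * t <= expR ((2 * T)^-1 * t) by exact: expR_ge1Dx.
have u0 : 0 <= (2 * T)^-1 * t by rewrite mulr_ge0 // invr_ge0 mulr_ge0 // ltW.
case: N => [|N].
  by rewrite big_ord0 mulr_ge0 ?expR_ge0 // mulr_ge0 // addr_ge0 // mulr_ge0 // sqr_ge0.
rewrite big_ord_recl /= addn0.
under eq_bigr do rewrite /bump leq0n add1n addnS -addSn.
apply: le_trans (lerD (boundary_wave_bound t0) (EN N)) _.
rewrite EE.
have -> : A * expR (T^-1 * t) + A * T * t * expR (T^-1 * t) =
  A * expR (T^-1 * t) * (1 + 2 * T ^+ 2 * ((2 * T)^-1 * t)) by field; rewrite gt_eqF.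
have -> : A * (1 + 2 * T ^+ 2) * (expR (T^-1 * t) * expR ((2 * T)^-1 * t)) =
  A * expR (T^-1 * t) * ((1 + 2 * T ^+ 2) * expR ((2 * T)^-1 * t)) by ring.
have TT : 0 <= 2 * T ^+ 2 by rewrite mulr_ge0 // sqr_ge0.
apply: ler_wpM2l; first by rewrite mulr_ge0 ?expR_ge0.
move: ((2 * T)^-1 * t) (2 * T ^+ 2) u0 TT E1 => u S u0 SS E1.
rewrite mulrDl mul1r; have := ler_wpM2l SS E1.
lra.
Qed.

End Transport.
End ChainPairing.

(** * Identification of the propagator with the wave series *)

Section Truncation.
Variable R : realType.

Lemma egf_truncation (A M : R) c t m : (forall k, `|c k| <= A * M ^+ k) ->
  `|pseries (fun k => c k / k`!%:R) t m - egf c t| <=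
  A * (expR (M * `|t|) - series (exp_coeff (M * `|t|)) m).
Proof.
move=> H; set x := M * `|t|; set u := pseries _ t.
have A0 : 0 <= A by have := H 0%N; rewrite expr0 mulr1; apply: le_trans.
have M0 : 0 <= A * x.
  rewrite /x mulrA mulr_ge0 //; have := H 1%N; rewrite expr1; exact: le_trans.
have cu : cvgn u by apply: egf_cvg; exists A, M.
have term k : `|c k / k`!%:R * t ^+ k| <= A * exp_coeff x k by exact: egf_norm_term.
have step N : (m <= N)%N -> `|u m - u N| <= A * (series (exp_coeff x) N - series (exp_coeff x) m).
  move=> mN; rewrite distrC /u /pseries !sub_series mN mulr_sumr.
  apply: le_trans (ler_norm_sum _ _ _) _; apply: ler_sum => k _; exact: term.
have lim N : (m <= N)%N -> A * series (exp_coeff x) N <= A * expR x.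
  move=> mN; have -> : A * expR x = limn (series (fun k => A * exp_coeff x k)).
    by rewrite lim_seriesZ //; exact: is_cvg_series_exp_coeff.
  rewrite /series /= mulr_sumr; apply: nondecreasing_cvgn_le.
    by apply: nondecreasing_series => k _ _; apply: le_trans (term k).
  by apply: (@is_cvg_seriesZ _ _ A); exact: is_cvg_series_exp_coeff.
have cl : u m - u N @[N --> \oo] --> u m - limn u.
  by apply: cvgB; [exact: cvg_cst|exact: cu].
have cn : cvgn (fun N => u m - u N) by apply/cvg_ex; exists (u m - limn u).
rewrite -[egf c t]/(limn u) -(cvg_lim _ cl) //.
rewrite -lim_norm //; apply: limr_le; first exact: is_cvg_norm.
exists m => // N /= mN; apply: le_trans (step _ mN) _.
by rewrite !mulrBr lerD2r lim.
Qed.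

Lemma exp_tail_cvg0 (x : R) : expR x - series (exp_coeff x) m @[m --> \oo] --> (0 : R).
Proof.
rewrite -[X in _ --> X](subrr (expR x)); apply: cvgB; first exact: cvg_cst.
exact: is_cvg_series_exp_coeff.
Qed.

End Truncation.

Section Amplitude.
Variables (R : realType) (V : nat -> R) (v : R).
Hypothesis Vv : forall n, `|V n| <= v.

Definition psi_re n (t : R) := wave_re (fun k => chain V 0 k n) t.
Definition psi_im n (t : R) := wave_im (fun k => chain V 0 k n) t.
Definition psi (t : R) : nat -> R[i] := fun n => (psi_re n t +i* psi_im n t)%C.

Lemma exp_partial_site t m n : exp_partial V t (delta R 0) m n =
  (pseries (fun k => quarter R k * chain V 0 k n / k`!%:R) t m +i*
   pseries (fun k => quarter R k.+1 * chain V 0 k n / k`!%:R) t m)%C.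
Proof.
have pw k : (- (0 +i* t)%C) ^+ k = (quarter R k * t ^+ k +i* (quarter R k.+1 * t ^+ k))%C.
  have [] // : (- (0 +i* t)%C) ^+ k = (quarter R k * t ^+ k +i* (quarter R k.+1 * t ^+ k))%C
    /\ (- (0 +i* t)%C) ^+ k.+1 = (quarter R k.+1 * t ^+ k.+1 +i* (quarter R k.+2 * t ^+ k.+1))%C.
  elim: k => [|k [IH1 IH2]].
    by split; apply/eqP; rewrite eq_complex /= ?expr0 ?expr1; apply/andP; split; apply/eqP; ring.
  split=> //; rewrite exprS IH2; apply/eqP; rewrite eq_complex /= !exprS.
  by apply/andP; split; apply/eqP; ring.
have it k : iter k (schrodinger V) (delta R 0) n = real_complex R (chain V 0 k n).
  elim: k n => [|k IH] n; first by rewrite /= /delta /chain /= /site; case: (n == 0%N).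
  rewrite -[LHS]/(schrodinger V (iter k (schrodinger V) (delta R 0)) n) /schrodinger.
  rewrite -[chain _ _ _ _]/(jacobi_op V (chain V 0 k) n) /jacobi_op.
  by case: n => [|n]; rewrite !IH /= ?addr0 !rmorphD ?rmorphM.
rewrite /exp_partial fct_sumE /pseries /series /= !big_mkord.
have -> (F G : 'I_m -> R) : ((\sum_k F k) +i* (\sum_k G k))%C = \sum_k (F k +i* G k)%C.
  elim: (index_enum _) => [|k s IH]; first by rewrite !big_nil.
  by rewrite !big_cons -IH.
apply: eq_bigr => k _; rewrite -[LHS]/(_ * _) it pw.
have -> : (k`!)%:R = real_complex R (k`!%:R) by rewrite rmorph_nat.
rewrite -fmorphV /=; apply/eqP; rewrite eq_complex /=.
by apply/andP; split; apply/eqP; ring.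
Qed.

(** The tail of the exponential series controls the error at every site, and the factor [2 ^ (- n)]
    makes it summable, giving convergence in l2. *)
Lemma psi_truncation t : exists D : nat -> R,
  [/\ D m @[m --> \oo] --> (0 : R), (forall m, 0 <= D m) &
  forall m n, Normc.normc (exp_partial V t (delta R 0) m n - psi t n) ^+ 2 <=
     D m * 2^-1 ^+ n].
Proof.
have [A [M [A0 M0 H]]] := chain_decay 0 Vv.
set x := M * `|t|.
pose tl m := expR x - series (exp_coeff x) m.
exists (fun m => 2 * A ^+ 2 * (tl m * tl m)); split.
- have tl2 : tl m * tl m @[m --> \oo] --> (0 : R).
    by rewrite -[X in _ --> X](mulr0 (0 : R)); apply: cvgM; exact: exp_tail_cvg0.
  rewrite -[X in _ --> X](mulr0 (2 * A ^+ 2)).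
  by apply: cvgM => //; exact: cvg_cst.
- move=> m; apply: mulr_ge0; first by rewrite mulr_ge0 // sqr_ge0.
  by rewrite -expr2 sqr_ge0.
move=> m n; rewrite exp_partial_site /psi /psi_re /psi_im /=.
rewrite sqr_sqrtr ?addr_ge0 ?sqr_ge0 //.
have Hn k : `|chain V 0 k n| <= A * 2^-1 ^+ n * M ^+ k by rewrite mulrAC.
have Hq b : forall k, `|quarter R (b + k) * chain V 0 k n| <= A * 2^-1 ^+ n * M ^+ k.
  by move=> k; rewrite normrM; apply: le_trans (Hn k); rewrite ler_piMl ?quarter_le1.
have h1 := egf_truncation t m (Hq 0%N); have h2 := egf_truncation t m (Hq 1%N).
rewrite -/x -/(tl m) in h1 h2.
have sq (y z : R) : `|y| <= z -> y ^+ 2 <= z ^+ 2.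
  move=> yz; rewrite -(real_normK (num_real y)) ler_sqr ?nnegrE //.
  exact: le_trans yz.
apply: le_trans (lerD (sq _ _ h1) (sq _ _ h2)) _.
have -> : (A * 2^-1 ^+ n * tl m) ^+ 2 + (A * 2^-1 ^+ n * tl m) ^+ 2 =
  2 * A ^+ 2 * (tl m * tl m) * (2^-1 ^+ n * 2^-1 ^+ n) by ring.
apply: ler_wpM2l.
  by apply: mulr_ge0; [rewrite mulr_ge0 // sqr_ge0|rewrite -expr2 sqr_ge0].
by rewrite ler_piMl ?exprn_ge0 // exprn_ile1 //; lra.
Qed.

Lemma l2_normsq_le (phi : nat -> R[i]) (D : R) :
  (forall n, Normc.normc (phi n) ^+ 2 <= D * 2^-1 ^+ n) ->
  (l2_normsq phi <= (2 * D)%:E)%E.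
Proof.
move=> H; have D0 : 0 <= D.
  by have := H 0%N; rewrite expr0 mulr1; apply: le_trans; rewrite sqr_ge0.
apply: lime_le.
  by apply: is_cvg_nneseries => n _ _; rewrite lee_fin sqr_ge0.
apply: nearW => N; rewrite sumEFin lee_fin.
apply: (@le_trans _ _ (\sum_(0 <= n < N) D * 2^-1 ^+ n)); first exact: ler_sum.
rewrite -mulr_sumr mulrC ler_wpM2r //.
elim: N => [|N IH]; first by rewrite big_nil.
have E N' : \sum_(0 <= i < N') 2^-1 ^+ i = 2 - 2 * 2^-1 ^+ N' :> R.
  elim: N' => [|N' IH']; first by rewrite big_nil expr0; ring.
  by rewrite big_nat_recr //= IH' exprS; field.
by rewrite E gerBl mulr_ge0 ?exprn_ge0.
Qed.

Lemma l2_coordinate_le (phi : nat -> R[i]) n :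
  ((Normc.normc (phi n) ^+ 2)%:E <= l2_normsq phi)%E.
Proof.
apply: le_trans (@nneseries_lim_ge R _ xpredT 0%N n.+1 _); last first.
  by move=> i _ _; rewrite lee_fin sqr_ge0.
rewrite big_nat_recr //= leeDr // sumEFin lee_fin.
by apply: sumr_ge0 => i _; rewrite sqr_ge0.
Qed.

Lemma l2_cvg_coordinate (f : nat -> nat -> R[i]) (phi : nat -> R[i]) n (eps : R) : 0 < eps ->
  l2_normsq (f m - phi) @[m --> \oo] --> 0%E ->
  \forall m \near \oo, Normc.normc (f m n - phi n) < eps.
Proof.
move=> eps0 /fine_cvgP[ffin /cvgr0Pnorm_lt fcvg].
have e2 : 0 < eps ^+ 2 by rewrite exprn_gt0.
near=> m.
have fin : l2_normsq (f m - phi) \is a fin_num by near: m.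
have small : `|(fine \o (fun m => l2_normsq (f m - phi))) m| < eps ^+ 2.
  by near: m; exact: fcvg.
have := l2_coordinate_le (f m - phi) n.
rewrite -(fineK fin) lee_fin => le1.
have : Normc.normc (f m n - phi n) ^+ 2 < eps ^+ 2.
  by apply: le_lt_trans le1 _; apply: le_lt_trans (ler_norm _) small.
rewrite ltr_sqr ?nnegrE ?(ltW eps0) //.
by case: (f m n - phi n) => a b /=; exact: sqrtr_ge0.
Unshelve. all: by end_near. Qed.

(** The l2 limit exists, and it is unique because l2 convergence forces convergence of coordinates;
    so [xget] does not return its default value. *)
Lemma exp_mitH_site (t : R) : exp_mitH V t (delta R 0) = psi t.
Proof.
have [D [D0 Dge H]] := psi_truncation t.
have psi_cvg : l2_normsq (exp_partial V t (delta R 0) m - psi t) @[m --> \oo] --> 0%E.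
  apply: (@squeeze_cvge _ _ _ _ (fun=> 0%E) _ (fun m => (2 * D m)%:E)).
  - apply: nearW => m; rewrite l2_normsq_le ?andbT; last by move=> n; exact: H.
    by apply: nneseries_ge0 => n _ _; rewrite lee_fin sqr_ge0.
  - exact: cvg_cst.
  - apply: cvg_EFin; first by apply: nearW.
    rewrite -[X in _ --> X](mulr0 (2 : R)); apply: cvgM => //; exact: cvg_cst.
apply: xget_unique; first split => //.
  (* The truncation of order 0 is the zero vector, so its error bound shows that [psi t] is in
     l2. *)
  apply: le_lt_trans (_ : (2 * D 0%N)%:E < +oo)%E; last exact: ltry.
  apply: l2_normsq_le => n.
  have -> : psi t n = - (exp_partial V t (delta R 0) 0 n - psi t n).
    by rewrite /exp_partial big_ord0 sub0r opprK.
  by rewrite normcN; exact: H.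
move=> phi [_ phi_cvg]; apply/funext => n; apply/eqP; rewrite -subr_eq0.
apply/eqP/Normc.eq0_normc/eqP; rewrite eq_le; apply/andP; split; last first.
  by case: (phi n - psi t n) => a b /=; exact: sqrtr_ge0.
apply/ler_addgt0Pr => eps eps0; rewrite add0r.
have e2 : 0 < eps / 2 by rewrite divr_gt0.
near \oo => m.
have h1 : Normc.normc (exp_partial V t (delta R 0) m n - phi n) < eps / 2.
  by near: m; exact: l2_cvg_coordinate.
have h2 : Normc.normc (exp_partial V t (delta R 0) m n - psi t n) < eps / 2.
  by near: m; exact: l2_cvg_coordinate.
have := le_normcD (- (exp_partial V t (delta R 0) m n - phi n))
  (exp_partial V t (delta R 0) m n - psi t n).
rewrite normcN opprB addrA subrK => tri.
by apply: le_trans tri _; lra.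
Unshelve. all: by end_near. Qed.

Lemma amplitude_normsq n (t : R) :
  Normc.normc (amplitude V n t) ^+ 2 = psi_re n t ^+ 2 + psi_im n t ^+ 2.
Proof.
by rewrite /amplitude exp_mitH_site /psi /= sqr_sqrtr // addr_ge0 ?sqr_ge0.
Qed.

End Amplitude.

(** * The outside probability as a time average *)

Section OutsideProb.
Variable R : realType.
Let mu := @lebesgue_measure R.

Lemma is_derive_continuous (f D : R -> R) :
  (forall x : R, is_derive x 1 f (D x)) -> continuous f.
Proof.
move=> fD x; apply: differentiable_continuous; apply/derivable1_diffP.
by case: (fD x).
Qed.

Lemma expRM_continuous (c : R) : continuous (fun t => expR (c * t)).
Proof. exact: is_derive_continuous (is_derive_expRM c). Qed.

Lemma integral_exp_decay (c : R) : 0 < c ->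
  (\int[mu]_(t in `[0%R, +oo[) (expR (- c * t))%:E = (c^-1)%:E)%E.
Proof.
move=> c0.
have dF (x : R) : is_derive x 1 (fun t => - c^-1 * expR (- c * t)) (expR (- c * x)).
  have -> : expR (- c * x) = - c^-1 * (- c * expR (- c * x)).
    by field; rewrite gt_eqF.
  by apply: is_derive_scale; exact: is_derive_expRM.
have cE : continuous (fun t : R => expR (- c * t)).
  exact: is_derive_continuous (is_derive_expRM (- c)).
have cF := is_derive_continuous dF.
rewrite (@ge0_continuous_FTC2y _ _ (fun t => - c^-1 * expR (- c * t)) 0 0).
- by rewrite mulr0 expR0 mulr1 EFinN oppeK add0e.
- by move=> x _; exact: expR_ge0.
- by apply: continuous_subspaceT.
- rewrite -[X in _ --> X](mulr0 (- c^-1)); apply: cvgM; first exact: cvg_cst.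
  rewrite (_ : (fun x => expR (- c * x)) = (fun z => expR (- z)) \o (fun z => c * z)); last first.
    by apply/funext => x; rewrite /= mulNr.
  apply: (@cvg_comp _ _ _ _ _ _ (pinfty_nbhs R)); last exact: cvgr_expR.
  exact: gt0_cvgMry.
- by move=> x _; case: (dF x).
- by apply/cvg_at_right_filter; exact: cF.
- by move=> x _; rewrite derive1E; case: (dF x).
Qed.

Variables (V : nat -> R) (v : R).
Hypothesis Vv : forall n, `|V n| <= v.

Lemma psi_re_continuous n : continuous (psi_re V n).
Proof.
apply: (@is_derive_continuous _ (wave_im (fun k => chain V 0 k.+1 n))) => x.
by apply: wave_re_derive; exact: chain_exp_type Vv.
Qed.

Lemma psi_im_continuous n : continuous (psi_im V n).
Proof.
apply: (@is_derive_continuous _ (fun t => - wave_re (fun k => chain V 0 k.+1 n) t)) => x.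
by apply: wave_im_derive; exact: chain_exp_type Vv.
Qed.

(** Against the weight [exp (- 2 t / T)] the bound leaves [K exp (- t / (2 T))], whose integral is
    [2 T K]; the prefactor [2 / T] gives [4 K]. *)
Lemma outside_prob_le (q : nat) (T K : R) : 0 < T ->
  (forall N t, 0 <= t -> \sum_(n < N) (psi_re V (q + n) t ^+ 2 + psi_im V (q + n) t ^+ 2)
     <= K * expR (3 / 2 * T^-1 * t)) ->
  (outside_prob V q T <= (4 * K)%:E)%E.
Proof.
move=> T0 H.
have K0 : 0 <= K.
  by have := H 0%N 0 (lexx _); rewrite big_ord0 mulr0 expR0 mulr1.
pose g n t := (psi_re V n t ^+ 2 + psi_im V n t ^+ 2) * expR (- (2 * t / T)).
have g0 n t : 0 <= g n t by rewrite mulr_ge0 ?expR_ge0 // addr_ge0 ?sqr_ge0.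
have sqc (f : R -> R) : continuous f -> continuous (fun t => f t ^+ 2).
  by move=> cf x; exact: (cvgM (cf x) (cf x)).
have cE : continuous (fun t : R => expR (- (2 * t / T))).
  have -> : (fun t : R => expR (- (2 * t / T))) = (fun t => expR (- (2 / T) * t)).
    by apply/funext => t; congr expR; ring.
  exact: expRM_continuous.
pose D : set R := [set` `[0%R, +oo[].
have mg n : measurable_fun D (EFin \o g n).
  apply/measurable_EFinP; apply: measurable_funTS; apply: continuous_measurable_fun => x.
  apply: cvgM.
    by apply: cvgD; apply: sqc; [exact: psi_re_continuous|exact: psi_im_continuous].
  exact: cE.
have E : outside_prob V q T =
   (\sum_(q <= n <oo) (2 / T)%:E * \int[mu]_(t in `[0%R, +oo[) (g n t)%:E)%E.
  rewrite /outside_prob; apply: eq_eseriesr => n _; congr (_ * _)%E.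
  by apply: eq_integral => t _; rewrite (amplitude_normsq Vv).
have i0 n : (0 <= \int[mu]_(t in `[0%R, +oo[) (g n t)%:E)%E.
  by apply: integral_ge0 => t _; rewrite lee_fin.
have T2 : (0 <= (2 / T)%:E)%E by rewrite lee_fin divr_ge0 // ltW.
rewrite E; apply: lime_le.
  by apply: is_cvg_nneseries => n _ _; rewrite mule_ge0.
apply: nearW => N.
rewrite -ge0_sume_distrr; last by move=> n _.
rewrite -ge0_integral_sum //; last by move=> n t _; rewrite lee_fin.
apply: (@le_trans _ _ ((2 / T)%:E *
   \int[mu]_(t in `[0%R, +oo[) (K%:E * (expR (- (2 * T)^-1 * t))%:E))%E).
  apply: lee_wpmul2l => //.
  have mK : measurable_fun D (fun t => K%:E * (expR (- (2 * T)^-1 * t))%:E)%E.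
    rewrite (_ : (fun t => _) = EFin \o (fun t => K * expR (- (2 * T)^-1 * t))) //.
    apply/measurable_EFinP; apply: measurable_funTS; apply: continuous_measurable_fun => x.
    apply: cvgM; first exact: cvg_cst.
    exact: expRM_continuous.
  apply: ge0_le_integral => //.
  - by move=> t _; apply: sume_ge0 => n _; rewrite lee_fin.
  - exact: emeasurable_sum.
  - move=> t /=; rewrite in_itv /= andbT => t0; rewrite sumEFin -EFinM lee_fin.
    rewrite -mulr_suml -{1}[q]add0n big_addn big_mkord.
    under eq_bigr do rewrite addnC.
    have -> : expR (- (2 * T)^-1 * t) = expR (3 / 2 * T^-1 * t) * expR (- (2 * t / T)).
      by rewrite -expRD; congr expR; field; rewrite gt_eqF.
    by rewrite mulrA ler_wpM2r ?expR_ge0 // H.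
have T2' : 0 < (2 * T)^-1 by rewrite invr_gt0 mulr_gt0.
have mexp : measurable_fun D (EFin \o (fun t => expR (- (2 * T)^-1 * t))).
  apply/measurable_EFinP; apply: measurable_funTS; apply: continuous_measurable_fun.
  exact: expRM_continuous.
have IK : (\int[mu]_(t in `[0%R, +oo[) (K%:E * (expR (- (2 * T)^-1 * t))%:E) =
    K%:E * ((2 * T)^-1^-1)%:E)%E.
  by rewrite -integral_exp_decay //; apply: ge0_integralZl.
rewrite IK -!EFinM lee_fin.
by rewrite le_eqVlt; apply/orP; left; apply/eqP; field; rewrite gt_eqF.
Qed.

End OutsideProb.

(** * Asymptotics *)

Section Asymptotics.
Variable R : realType.

Lemma exp_ge_pow2 n : 2 ^+ n <= expR (n%:R : R).
Proof.
have e2 : 2 <= expR (1 : R) by apply: le_trans (expR_ge1Dx _); lra.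
have -> : expR (n%:R : R) = expR 1 ^+ n by rewrite -expRM_natl mulr1.
by rewrite lerXn2r ?nnegrE ?expR_ge0.
Qed.

(** Here [y] is the cube root of [q]. Powers of [q] and [T] are exponentials of multiples of [y],
    whereas the gain is exponential in [p], hence in [y ^ 2]. *)
Lemma decay_estimate (alpha T y Q : R) (p : nat) : 0 < alpha -> 0 < T ->
  16 / 3 * (15 + 6 / alpha) <= y -> Q = y ^+ 3 -> T <= Q `^ alpha^-1 ->
  y ^+ 2 / 2 < p.+1%:R ->
  32 * T * (1 + 16 * T ^+ 2) * (1 + 2 * T ^+ 2) * Q ^+ 2 / Num.min 1 T^-1
    / (8 / 5 * Num.max 1 T^-1) ^+ p <= 16 * T ^+ 4 * expR (- y).
Proof.
move=> al0 T0 hy QE TQ py.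
have ial : 0 < 6 / alpha by rewrite divr_gt0.
have y80 : 80 <= y by lra.
have p3 : (3 <= p)%N.
  rewrite -ltnS -(ltr_nat R); apply: le_lt_trans py; nra.
have Q0 : 0 <= Q by rewrite QE exprn_ge0 //; lra.
have yexp : y <= expR y by apply: le_trans (expR_ge1Dx _); lra.
have Qexp : Q <= expR (3 * y).
  by rewrite QE expRM_natl lerXn2r ?nnegrE ?expR_ge0 //; lra.
have Q2exp : Q ^+ 2 <= expR (6 * y).
  have -> : expR (6 * y) = expR (3 * y) ^+ 2 by rewrite -expRM_natl; congr expR; ring.
  by rewrite lerXn2r ?nnegrE ?expR_ge0.
have Texp : T <= expR (3 * y / alpha).
  apply: le_trans TQ _; rewrite expRM; apply: ge0_ler_powR; rewrite ?nnegrE ?expR_ge0 //.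
  by rewrite invr_ge0 ltW.
have T2exp : T ^+ 2 <= expR (6 / alpha * y).
  have -> : expR (6 / alpha * y) = expR (3 * y / alpha) ^+ 2.
    by rewrite -expRM_natl; congr expR; ring.
  by rewrite lerXn2r ?nnegrE ?expR_ge0 // ltW.
set P := (5 / 8 : R) ^+ p.
have P0 : 0 <= P by rewrite exprn_ge0 //; lra.
(* [5/8 = 1 - 3/8] is at most [exp (- 3/8)], and [p > y ^ 2 / 2 - 1]. The constant 102 is
   [2 * 17 * 3], collected in the two cases below. *)
have Pexp : 102 * P <= expR (8 - 3 / 16 * y ^+ 2).
  have P1 : P <= expR (p%:R * - (3 / 8)).
    rewrite expRM_natl lerXn2r ?nnegrE ?expR_ge0 ?divr_ge0 //.
    by apply: le_trans (expR_ge1Dx _); lra.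
  have c : 102 <= expR (7 : R).
    apply: le_trans (exp_ge_pow2 7); rewrite !exprS expr0; lra.
  apply: (@le_trans _ _ (expR 7 * expR (p%:R * - (3 / 8)))).
    by rewrite ler_pM.
  rewrite -expRD ler_expR.
  by move: py; rewrite -[p.+1%:R]natr1; lra.
(* The threshold on [y] gives [3/16 y ^ 2 >= (15 + 6 / alpha) y], which covers the exponents [6 y],
   [6 y / alpha], 8 and the final [y]. *)
have main X : 0 <= X -> X <= expR (6 / alpha * y) -> 102 * Q ^+ 2 * X * P <= expR (- y).
  move=> X0 XE.
  apply: (@le_trans _ _ (expR (6 * y) * expR (6 / alpha * y) * expR (8 - 3 / 16 * y ^+ 2))).
    have -> : 102 * Q ^+ 2 * X * P = Q ^+ 2 * X * (102 * P) by ring.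
    by rewrite !ler_pM ?mulr_ge0 ?exprn_ge0.
  rewrite -!expRD ler_expR.
  have := ler_wpM2r (_ : 0 <= y) hy; have -> : 0 <= y by lra.
  by move=> /(_ isT); have : (6 / alpha) * y >= 0 by [rewrite mulr_ge0 //; lra]; lra.
have E1 : 0 < expR (- y) by exact: expR_gt0.
have PE x : (8 / 5 * x) ^+ p = x ^+ p / P.
  by rewrite exprMn /P -exprVn invf_div mulrC.
have P0' : P != 0 by rewrite expf_neq0 //; lra.
(* For [T >= 1] the prefactor is of order [T ^ 6]: four powers are kept and [T ^ 2] is absorbed by
   the decay. For [T < 1] the gain contains an extra [T ^ (- p)], and [p >= 3] turns [T ^ (p + 1)]
   into at most [T ^ 4]. *)
have [T1|T1] := leP 1 T.
  have Ti1 : T^-1 <= 1 by rewrite invf_le1.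
  rewrite (min_idPr Ti1) (max_idPl Ti1) PE expr1n.
  have mn := main (T ^+ 2) (sqr_ge0 _) T2exp.
  rewrite invf_div divr1 invrK.
  apply: (@le_trans _ _ (16 * T ^+ 4 * (102 * Q ^+ 2 * T ^+ 2 * P))); last first.
    by rewrite ler_wpM2l // mulr_ge0 // exprn_ge0 // ltW.
  have -> : 16 * T ^+ 4 * (102 * Q ^+ 2 * T ^+ 2 * P) =
    32 * T * (17 * T ^+ 2) * (3 * T ^+ 2) * Q ^+ 2 * T * P by ring.
  have T21 : 1 <= T ^+ 2 by rewrite exprn_ege1.
  rewrite ler_wpM2r // ler_wpM2r ?(ltW T0) // ler_wpM2r ?sqr_ge0 //.
  rewrite ler_pM ?mulr_ge0 ?addr_ge0 ?mulr_ge0 ?(ltW T0) ?sqr_ge0 //; last by lra.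
  by rewrite ler_wpM2l ?mulr_ge0 ?(ltW T0) //; lra.
have Ti1 : 1 <= T^-1 by rewrite invf_ge1 // ltW.
rewrite (min_idPl Ti1) (max_idPr Ti1) PE divr1.
have mn : 102 * Q ^+ 2 * P <= expR (- y).
  rewrite -[102 * Q ^+ 2]mulr1; apply: main => //.
  apply: le_trans (expR_ge1Dx _); rewrite lerDl mulr_ge0 ?(ltW ial) //.
  by lra.
rewrite invf_div exprVn invrK.
apply: (@le_trans _ _ (16 * T ^+ 4 * (102 * Q ^+ 2 * P))); last first.
  by rewrite ler_wpM2l // mulr_ge0 // exprn_ge0 // ltW.
have T21 : T ^+ 2 <= 1 by rewrite exprn_ile1 // ltW.
have Tp : T * T ^+ p <= T ^+ 4.
  by rewrite -exprS ler_wiXn2l // ?(ltW T0) ?(ltW T1).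
have -> : 16 * T ^+ 4 * (102 * Q ^+ 2 * P) = 32 * 17 * 3 * Q ^+ 2 * P * T ^+ 4 by ring.
apply: (@le_trans _ _ (32 * 17 * 3 * Q ^+ 2 * P * (T * T ^+ p))); last first.
  by rewrite ler_wpM2l // !mulr_ge0 // sqr_ge0.
have -> : 32 * T * (1 + 16 * T ^+ 2) * (1 + 2 * T ^+ 2) * Q ^+ 2 * (P * T ^+ p) =
  32 * (1 + 16 * T ^+ 2) * (1 + 2 * T ^+ 2) * (Q ^+ 2 * P * (T * T ^+ p)) by ring.
have -> : 32 * 17 * 3 * Q ^+ 2 * P * (T * T ^+ p) =
  32 * 17 * 3 * (Q ^+ 2 * P * (T * T ^+ p)) by ring.
have Z0 : 0 <= Q ^+ 2 * P * (T * T ^+ p).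
  by rewrite mulr_ge0 ?mulr_ge0 ?sqr_ge0 ?exprn_ge0 // ltW.
rewrite ler_wpM2r // ler_pM //; try lra; have := sqr_ge0 T; lra.
Qed.

End Asymptotics.

(** * The nodes of the operator and the final estimate *)

Section FloquetNodes.
Variables (R : realType) (V : nat -> R) (r : nat).
Let q := r.+3.

Definition floquet_node (j : 'I_q) : R := Etilde V q j.

Lemma discriminant_Etilde : discriminant V q = node_poly floquet_node.
Proof.
have [H sz] := @discriminant_eigenvalues R V q (pi / 2) isT.
rewrite /node_poly -[LHS]subr0 -polyC0 -(mulr0 2) -cos_pihalf H.
by rewrite (big_nth 0) big_mkord sz.
Qed.

Lemma max_bandwidth_ge j : (j < q)%N -> bandwidth V q j <= max_bandwidth V q.
Proof.
by move=> jq; rewrite /max_bandwidth (bigD1 (Ordinal jq)) //= le_max lexx.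
Qed.

Lemma floquet_node_derivative j :
  1 <= max_bandwidth V q * `|(discriminant V q)^`().[floquet_node j]|.
Proof.
have [H0 s0] := @discriminant_eigenvalues R V q 0 isT.
have [Hp sp] := @discriminant_eigenvalues R V q pi isT.
rewrite cos0 mulr1 in H0; rewrite cospi mulrN1 polyCN opprK in Hp.
have e0 : (discriminant V q).[floquet_node j] = 0.
  by rewrite discriminant_Etilde /node_poly horner_prod (bigD1 j) //= hornerXsubC subrr mul0r.
have sz : size (eigenvalues (floquet_mx V q 0)) = size (eigenvalues (floquet_mx V q pi)).
  exact: etrans s0 (esym sp).
have BD := band_derivative H0 Hp sz.
apply: BD e0 => k; rewrite s0 => kq.
rewrite distrC; exact: max_bandwidth_ge.
Qed.

(** The lower bound on the derivative excludes multiple zeros of the discriminant. *)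
Lemma floquet_node_inj : injective floquet_node.
Proof.
have [H sz] := @discriminant_eigenvalues R V q (pi / 2) isT.
have U : uniq (eigenvalues (floquet_mx V q (pi / 2))).
  apply: simple_roots_uniq => x xs; rewrite -H cos_pihalf mulr0 subr0.
  have [j jq jE] := nthP 0 xs; rewrite sz in jq.
  have := floquet_node_derivative (Ordinal jq); rewrite /floquet_node /Etilde /Eband /= jE.
  by apply: contraTneq => ->; rewrite normr0 mulr0 ler10.
move=> i j /eqP; rewrite /floquet_node /Etilde /Eband nth_uniq ?sz //.
by move=> /eqP ij; exact: val_inj.
Qed.

Lemma floquet_node_weight j : `|node_weight floquet_node j| <= max_bandwidth V q.
Proof.
have := floquet_node_derivative j; rewrite discriminant_Etilde.
set d := _.[_] => H; rewrite /node_weight normfV -/d.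
have d0 : 0 < `|d|.
  by rewrite normr_gt0; apply: contraTneq H => ->; rewrite normr0 mulr0 ler10.
by rewrite -[leLHS]mul1r ler_pdivrMr.
Qed.

Lemma max_bandwidth_gt0 : 0 < max_bandwidth V q.
Proof.
have := floquet_node_derivative ord0; have := normr_ge0 (discriminant V q)^`().[floquet_node ord0].
by move=> d0 H; rewrite ltNge; apply/negP => B0; nra.
Qed.

(** Every node lies in a cluster interval, and all nodes of that interval are within [eps] of it. *)
Lemma clustered_card (eps xi c : R) (p : nat) :
  clustered q eps xi (frakE V q) -> eps <= c -> (2 * p)%:R <= q%:R `^ xi ->
  forall j, (2 * p <= #|[set l | (`|floquet_node j - floquet_node l| <= c)%R]%SET|)%N.
Proof.
move=> [m [a [b [_ len _ cov crd]]]] epsc px j.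
have [i _ ji] : (\bigcup_(i in [set: 'I_m]) [set` `[a i, b i]]) (floquet_node j).
  by apply: cov; exists (j : nat) => //=.
have fin : finite_set (frakE V q `&` [set` `[a i, b i]]).
  by apply: finite_setIl; apply: finite_image; exact: finite_II.
have := le_trans px (crd i); rewrite ler_nat => /leq_trans; apply.
rewrite cardE -(size_map floquet_node); apply: uniq_leq_size => [|x].
  exact: fset_uniq.
rewrite -[_ \in _]/(x \in fset_set _) in_fset_set // inE => -[[l lq <-] lI].
apply/mapP; exists (Ordinal lq) => //; rewrite mem_enum inE.
apply: le_trans epsc; apply: le_trans (len i).2.
move: ji lI; rewrite /= !in_itv /= /floquet_node /= => /andP[h1 h2] /andP[h3 h4].
by rewrite ler_norml; lra.
Qed.

End FloquetNodes.

Lemma outside_prob_clustered (R : realType) (V : nat -> R) (v xi alpha T : R) (r : nat) :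
  (forall n, `|V n| <= v) -> 2 / 3 < xi -> 0 < alpha -> alpha < 1 -> 0 < T ->
  16 / 3 * (15 + 6 / alpha) <= r.+3%:R `^ (1 / 3) ->
  clustered r.+3 (r.+3%:R `^ (- alpha^-1)) xi (frakE V r.+3) ->
  T <= r.+3%:R `^ (alpha^-1) ->
  (outside_prob V r.+3 T <=
    (16 * T ^+ 4 * max_bandwidth V r.+3 ^+ 2 * expR (- r.+3%:R `^ (1 / 3)))%:E)%E.
Proof.
move=> Vv xi23 al0 al1 T0; set q := r.+3; set y : R := q%:R `^ (1 / 3) => hy cl TQ.
have q1 : 1 <= q%:R :> R by rewrite ler1n.
have q0 : 0 <= q%:R :> R by [].
have y0 : 0 <= y by exact: powR_ge0.
have QE : q%:R = y ^+ 3.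
  by rewrite /y -powR_mulrn ?powR_ge0 // -powRrM mul1r mulVf // powRr1.
have y2 : y ^+ 2 <= q%:R `^ xi.
  by rewrite /y -powR_mulrn ?powR_ge0 // -powRrM; apply: ler_powR => //; lra.
(* Thus [2 p <= y ^ 2 = q ^ (2/3) <= q ^ xi], using [xi > 2/3]. *)
pose p := Num.truncn (y ^+ 2 / 2).
have /andP[p1 p2] : p%:R <= y ^+ 2 / 2 < p.+1%:R by apply: truncn_itv; rewrite divr_ge0 ?sqr_ge0.
have px : (2 * p)%:R <= q%:R `^ xi by apply: le_trans y2; rewrite natrM; lra.
have h0 : 0 < T^-1 by rewrite invr_gt0.
(* The cluster length is at most [1 / T] precisely because [T <= q ^ (1 / alpha)], and at most 1
   because [q >= 1]. *)
have epsc : q%:R `^ (- alpha^-1) <= Num.min 1 T^-1.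
  have Q1 : 1 <= q%:R `^ alpha^-1.
    by rewrite -[leLHS](powRr0 (q%:R)); apply: ler_powR => //; rewrite invr_ge0 ltW.
  rewrite powRN le_min invf_le1 ?(lt_le_trans ltr01) // Q1 /=.
  by rewrite lef_pV2 ?posrE ?(lt_le_trans ltr01 Q1).
have card_l := clustered_card cl epsc px.
have gram := node_gram_le (@floquet_node_inj R V r) (isT : (0 < q)%N) h0
  (@floquet_node_weight R V r) card_l.
set kap := (X in _ <= X) in gram.
set B := max_bandwidth V q in kap gram *.
have B0 : 0 < B by exact: max_bandwidth_gt0.
have c0 : 0 < Num.min 1 T^-1 by rewrite lt_min ltr01.
have G0 : 0 < (8 / 5 * Num.max 1 T^-1) ^+ p by rewrite exprn_gt0 // mulr_gt0 // lt_max ltr01.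
have kap0 : 0 < kap.
  by rewrite /kap !divr_gt0 // mulr_gt0 // ?exprn_gt0 // mulr_gt0 // exprn_gt0 // ltr0n.
have tail := tail_wave_bound Vv (@floquet_node_inj R V r) (@discriminant_Etilde R V r) T0 kap0 gram.
have := outside_prob_le Vv T0 tail.
move=> /le_trans; apply; rewrite lee_fin.
have est := decay_estimate al0 T0 hy QE TQ p2.
have rearrange (x z n b : R) :
  4 * (2 * n ^+ 2 * b ^+ 2 / x / z * (4 * T * (1 + 16 * T ^+ 2)) * (1 + 2 * T ^+ 2)) =
  32 * T * (1 + 16 * T ^+ 2) * (1 + 2 * T ^+ 2) * n ^+ 2 / x / z * b ^+ 2.
  by move: x^-1 z^-1 => x' z'; ring.
have -> : 4 * (kap * (4 * T * (1 + 16 * T ^+ 2)) * (1 + 2 * T ^+ 2)) =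
  32 * T * (1 + 16 * T ^+ 2) * (1 + 2 * T ^+ 2) * q%:R ^+ 2 / Num.min 1 T^-1
    / (8 / 5 * Num.max 1 T^-1) ^+ p * B ^+ 2.
  exact: rearrange.
have -> : 16 * T ^+ 4 * B ^+ 2 * expR (- y) = 16 * T ^+ 4 * expR (- y) * B ^+ 2 by ring.
by rewrite ler_wpM2r ?sqr_ge0.
Qed.

Theorem theorem1p5 (R : realType) :
  exists C : R, 0 < C /\
    forall xi alpha : R, 2 / 3 < xi -> xi <= 1 -> 0 < alpha -> alpha < 1 ->
    exists delta q0 : R, [/\ 0 < delta, 0 < q0 &
      forall (V : nat -> R) (q : nat),
        bounded_fun V -> (1 < q)%N -> q0 <= q%:R ->
        clustered q (q%:R `^ (- alpha^-1)) xi (frakE V q) ->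
        (forall T : R, 0 < T -> T <= q%:R `^ (alpha^-1) ->
           (outside_prob V q T <=
             (4 * expR 1 ^+ 2 * (1 + 2 * sup_norm V) ^+ 2 * T ^+ 4 *
              max_bandwidth V q ^+ 2 *
              expR (- (C * q%:R `^ delta)))%:E)%E) /\
        (outside_prob V q (q%:R `^ (alpha^-1)) <=
          (4 * expR 1 ^+ 2 * (1 + 2 * sup_norm V) ^+ 2 *
           q%:R `^ (4 / alpha) * max_bandwidth V q ^+ 2 *
           expR (- (C * q%:R `^ delta)))%:E)%E].
Proof.
exists 1; split=> // xi alpha xi23 xi1 al0 al1.
pose y0 : R := 16 / 3 * (15 + 6 / alpha).
have ial : 0 < 6 / alpha by rewrite divr_gt0.
have y0_gt : 80 < y0 by rewrite /y0; lra.
(* The exponent 1/3 comes from [y = q ^ (1/3)], and [q >= y0 ^ 3] says that [y] passes the threshold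
   of [decay_estimate]. *)
exists (1 / 3), (y0 ^+ 3); split=> //; first by rewrite exprn_gt0 //; lra.
move=> V q Vb q1 qq0 cl.
have q3 : (2 < q)%N.
  rewrite ltnNge; apply/negP => q2.
  have : (q%:R : R) <= 2 by rewrite ler_nat.
  have : y0 ^+ 3 = y0 * y0 ^+ 2 by rewrite exprS.
  by have : 1 <= y0 ^+ 2 by [rewrite exprn_ege1 //; lra]; nra.
have qpos : 0 < q%:R `^ alpha^-1 :> R by rewrite powR_gt0 // ltr0n; lia.
have hy : y0 <= q%:R `^ (1 / 3).
  have -> : y0 = (y0 ^+ 3) `^ (1 / 3).
    by rewrite -powR_mulrn -?powRrM; [rewrite mulrC mul1r mulVf // powRr1|]; lra.
  by apply: ge0_ler_powR; rewrite ?nnegrE ?exprn_ge0 //; lra.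
have [M0 VM] : exists M0 : R, forall n, `|V n| <= M0.
  have [M [_ HM]] := Vb; exists (M + 1) => n; apply: HM => //; rewrite ltrDl //.
have first_claim (T : R) : 0 < T -> T <= q%:R `^ (alpha^-1) ->
   (outside_prob V q T <=
     (4 * expR 1 ^+ 2 * (1 + 2 * sup_norm V) ^+ 2 * T ^+ 4 *
      max_bandwidth V q ^+ 2 * expR (- (1 * q%:R `^ (1 / 3))))%:E)%E.
  move=> T0 TQ; case: q q3 {q1 qq0 qpos} cl hy TQ => [|[|[|r]]] // _ cl hy TQ.
  apply: le_trans (outside_prob_clustered VM xi23 al0 al1 T0 hy cl TQ) _.
  rewrite lee_fin [1 * (_ `^ _)]mul1r.
  have e1 : 2 <= expR (1 : R) by apply: le_trans (expR_ge1Dx _); lra.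
  have s1 : 1 <= (1 + 2 * sup_norm V) ^+ 2.
    have s0 : 0 <= sup_norm V.
      apply: le_trans (normr_ge0 (V 0%N)) _; apply: ub_le_sup; last by exists 0%N.
      by exists M0 => _ [n _ <-].
    by rewrite exprn_ege1 // lerDl mulr_ge0.
  (* The estimate holds with constant 16; it is weakened by [e >= 2] and [1 + 2 sup_norm V >= 1]. *)
  have e2 : 16 <= 4 * expR (1 : R) ^+ 2 by nra.
  have mono (a b c : R) : 0 <= c -> a <= b -> a * c <= b * c.
    by move=> c0 ab; rewrite ler_wpM2r.
  apply: (mono _ _ _); first exact: expR_ge0.
  apply: (mono _ _ _); first exact: sqr_ge0.
  apply: (mono _ _ _); first by rewrite exprn_ge0 // ltW.
  by apply: le_trans e2 _; rewrite ler_peMr // mulr_ge0 // sqr_ge0.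
split=> //; have := first_claim _ qpos (lexx _).
congr (_ <= (_ * _ * _ * _)%:E)%E.
by rewrite -powR_mulrn ?powR_ge0 // -powRrM mulrC.
Qed.
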